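(* Let $k$ be a perfect field of positive characteristic $p$. Let $1\to F\to G\to H\to 1$ be a sequence of $k$-group schemes which is exact for the fpqc topology on $(\mathrm{Sch}/k)$. Then the sequence of perfect $k$-group schemes $$1\to F^{\mathrm{pf}}\to G^{\mathrm{pf}}\to H^{\mathrm{pf}}\to 1$$ is exact for the fpqc topology on $(\mathrm{Perf}/k)$.
   Context: $(\mathrm{Sch}/k)$ is the category of $k$-schemes. An $\mathbb F_p$-scheme $Y$ is perfect if its absolute Frobenius endomorphism $F_Y$ is an isomorphism; $(\mathrm{Perf}/k)$ is the full subcategory of $(\mathrm{Sch}/k)$ of perfect schemes. The inverse perfection of an $\mathbb F_p$-scheme $Y$ is the pair $(Y^{\mathrm{pf}},\phi_Y)$ consisting of a perfect $\mathbb F_p$-scheme $Y^{\mathrm{pf}}$ and a morphism $\phi_Y\colon Y^{\mathrm{pf}}\to Y$ such that every morphism from a perfect $\mathbb F_p$-scheme to $Y$ factors uniquely through $\phi_Y$. It always exists; for $Y=\operatorname{Spec}A$ one has $Y^{\mathrm{pf}}=\operatorname{Spec}A^{\mathrm{pf}}$, where $A^{\mathrm{pf}}=\varinjlim(A\to A\to\cdots)$ with all transition maps equal to $a\mapsto a^p$, and in general it is obtained by gluing. If $Y$ is a $k$-scheme then $Y^{\mathrm{pf}}$ is a $k$-scheme via $\phi_Y$ and the universal property holds over $k$. The functor $Y\mapsto Y^{\mathrm{pf}}$ commutes with fiber products, so the inverse perfection of a $k$-group scheme is a $k$-group scheme. An fpqc morphism is a faithfully flat morphism of schemes $f\colon X\to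 Y$ such that every $x\in X$ has an open neighborhood $U$ with $f(U)$ open in $Y$ and $U\to f(U)$ quasi-compact. The fpqc topology on $(\mathrm{Sch}/k)$ is the one whose coverings are the families of flat morphisms $\{X_\alpha\to X\}$ such that $\coprod X_\alpha\to X$ is an fpqc morphism. A family of morphisms in $(\mathrm{Perf}/k)$ is an fpqc covering in $(\mathrm{Perf}/k)$ if it is an fpqc covering in $(\mathrm{Sch}/k)$. A sequence $1\to F\to G\to H\to 1$ of groups in $\mathcal C=(\mathrm{Sch}/k)$ or $(\mathrm{Perf}/k)$ is exact for the fpqc topology on $\mathcal C$ if the sequence of represented sheaves of groups on $\mathcal C$ is exact, i.e., $\operatorname{Hom}_k(-,F)$ is identified with the kernel of $\operatorname{Hom}_k(-,G)\to\operatorname{Hom}_k(-,H)$ and the latter map is locally surjective: for every $U\in\mathcal C$, every $s\in H(U)$ lifts to $G$ after pullback to the members of some fpqc covering of $U$ in $\mathcal C$. *)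

(* Defs.v *)
From HB Require Import structures.
From mathcomp Require Import all_boot all_algebra.
From mathcomp Require Import generic_quotient all_classical.
From mathcomp Require Import topology ring.

Set Implicit Arguments.
Unset Strict Implicit.
Unset Printing Implicit Defensive.

Import GRing.Theory.
Local Open Scope classical_set_scope.
Local Open Scope ring_scope.

(* Rings of sections over the empty set are zero: rings have to be
   comPzRingType rather than comNzRingType. *)

Section MkRMorphism.
Variables (R S : comPzRingType) (f : R -> S).
Hypotheses (fB : forall x y, f (x - y) = f x - f y) (f1 : f 1 = 1)
  (fM : forall x y, f (x * y) = f x * f y).

Definition rmor_fun : R -> S := let _ := (fB, f1, fM) in f.

HB.instance Definition _ := GRing.isZmodMorphism.Build R S rmor_fun fB.
HB.instance Definition _ :=
  GRing.isMonoidMorphism.Build R S rmor_fun (f1, fM).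

Definition mk_rmorphism : {rmorphism R -> S} := rmor_fun.
End MkRMorphism.

Lemma rmorphism_ext (R S : comPzRingType) (f g : {rmorphism R -> S}) :
  f =1 g -> f = g.
Proof.
case: f g => f [[a1] [a2]] [g [[b1] [b2]]] /= /funext fg; subst g.
by rewrite (Prop_irrelevance a1 b1) (Prop_irrelevance a2 b2).
Qed.

(* A commutative ring up to an equivalence relation; its quotient is used for
   stalks (germs) and for localizations (fractions). *)
Record ring_setoid := RingSetoid {
  rs_sort :> Type;
  rs_eq : rs_sort -> rs_sort -> Prop;
  rs_zero : rs_sort;
  rs_one : rs_sort;
  rs_opp : rs_sort -> rs_sort;
  rs_add : rs_sort -> rs_sort -> rs_sort;
  rs_mul : rs_sort -> rs_sort -> rs_sort;
  rs_refl : forall x, rs_eq x x;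
  rs_sym : forall x y, rs_eq x y -> rs_eq y x;
  rs_trans : forall y x z, rs_eq x y -> rs_eq y z -> rs_eq x z;
  rs_oppP : forall x x', rs_eq x x' -> rs_eq (rs_opp x) (rs_opp x');
  rs_addP : forall x x' y y', rs_eq x x' -> rs_eq y y' ->
    rs_eq (rs_add x y) (rs_add x' y');
  rs_mulP : forall x x' y y', rs_eq x x' -> rs_eq y y' ->
    rs_eq (rs_mul x y) (rs_mul x' y');
  rs_addA : forall x y z,
    rs_eq (rs_add x (rs_add y z)) (rs_add (rs_add x y) z);
  rs_addC : forall x y, rs_eq (rs_add x y) (rs_add y x);
  rs_add0 : forall x, rs_eq (rs_add rs_zero x) x;
  rs_addN : forall x, rs_eq (rs_add (rs_opp x) x) rs_zero;
  rs_mulA : forall x y z,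
    rs_eq (rs_mul x (rs_mul y z)) (rs_mul (rs_mul x y) z);
  rs_mulC : forall x y, rs_eq (rs_mul x y) (rs_mul y x);
  rs_mul1 : forall x, rs_eq (rs_mul rs_one x) x;
  rs_mulDl : forall x y z,
    rs_eq (rs_mul (rs_add x y) z) (rs_add (rs_mul x z) (rs_mul y z)) }.

Section QuotientRing.
Variable S : ring_setoid.
Local Open Scope quotient_scope.

Definition rs_rel : rel {classic S} := fun x y => `[< @rs_eq S x y >].

Lemma rs_rel_refl : reflexive rs_rel.
Proof. by move=> x; apply/asboolP; apply: rs_refl. Qed.

Lemma rs_rel_sym : symmetric rs_rel.
Proof.
by move=> x y; apply/asboolP/asboolP; apply: rs_sym.
Qed.

Lemma rs_rel_trans : transitive rs_rel.
Proof.
by move=> y x z /asboolP xy /asboolP yz; apply/asboolP; apply: rs_trans yz.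
Qed.

Canonical rs_equiv := EquivRel rs_rel rs_rel_refl rs_rel_sym rs_rel_trans.

Definition qring : Type := {eq_quot rs_equiv}.
HB.instance Definition _ := Choice.copy qring {eq_quot rs_equiv}.

Definition qclass (x : S) : qring := \pi_{eq_quot rs_equiv} (x : {classic S}).
Definition qrepr (a : qring) : S :=
  (repr (a : {eq_quot rs_equiv}) : {classic S}).

Lemma qreprK a : qclass (qrepr a) = a.
Proof. exact: reprK. Qed.

Lemma qclassP x y : qclass x = qclass y <-> rs_eq x y.
Proof.
by split=> [/eqmodP/asboolP//|xy]; apply/eqmodP/asboolP.
Qed.

Lemma qrepr_eq x : rs_eq (qrepr (qclass x)) x.
Proof. by apply/qclassP; rewrite qreprK. Qed.

Lemma qring_ind (P : qring -> Prop) : (forall x, P (qclass x)) -> forall a, P a.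
Proof. by move=> Px a; rewrite -(qreprK a). Qed.

Definition qadd a b := qclass (rs_add (qrepr a) (qrepr b)).
Definition qmul a b := qclass (rs_mul (qrepr a) (qrepr b)).
Definition qopp a := qclass (rs_opp (qrepr a)).

Lemma qaddE x y : qadd (qclass x) (qclass y) = qclass (rs_add x y).
Proof. by apply/qclassP; apply: rs_addP; apply: qrepr_eq. Qed.

Lemma qmulE x y : qmul (qclass x) (qclass y) = qclass (rs_mul x y).
Proof. by apply/qclassP; apply: rs_mulP; apply: qrepr_eq. Qed.

Lemma qoppE x : qopp (qclass x) = qclass (rs_opp x).
Proof. by apply/qclassP; apply: rs_oppP; apply: qrepr_eq. Qed.

Lemma qaddA : associative qadd.
Proof.
elim/qring_ind=> x; elim/qring_ind=> y; elim/qring_ind=> z.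
by rewrite !qaddE; apply/qclassP; apply: rs_addA.
Qed.

Lemma qaddC : commutative qadd.
Proof.
elim/qring_ind=> x; elim/qring_ind=> y.
by rewrite !qaddE; apply/qclassP; apply: rs_addC.
Qed.

Lemma qadd0 : left_id (qclass (@rs_zero S)) qadd.
Proof.
by elim/qring_ind=> x; rewrite !qaddE; apply/qclassP; apply: rs_add0.
Qed.

Lemma qaddN : left_inverse (qclass (@rs_zero S)) qopp qadd.
Proof.
by elim/qring_ind=> x; rewrite qoppE qaddE; apply/qclassP; apply: rs_addN.
Qed.

HB.instance Definition _ := GRing.isZmodule.Build qring qaddA qaddC qadd0 qaddN.

Lemma qmulA : associative qmul.
Proof.
elim/qring_ind=> x; elim/qring_ind=> y; elim/qring_ind=> z.
by rewrite !qmulE; apply/qclassP; apply: rs_mulA.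
Qed.

Lemma qmulC : commutative qmul.
Proof.
elim/qring_ind=> x; elim/qring_ind=> y.
by rewrite !qmulE; apply/qclassP; apply: rs_mulC.
Qed.

Lemma qmul1 : left_id (qclass (@rs_one S)) qmul.
Proof.
by elim/qring_ind=> x; rewrite !qmulE; apply/qclassP; apply: rs_mul1.
Qed.

Lemma qmulDl : left_distributive qmul qadd.
Proof.
elim/qring_ind=> x; elim/qring_ind=> y; elim/qring_ind=> z.
by rewrite !(qaddE, qmulE); apply/qclassP; apply: rs_mulDl.
Qed.

HB.instance Definition _ :=
  GRing.Zmodule_isComPzRing.Build qring qmulA qmulC qmul1 qmulDl.

Lemma qclassD x y : qclass (rs_add x y) = qclass x + qclass y.
Proof. by rewrite -qaddE. Qed.

Lemma qclassM x y : qclass (rs_mul x y) = qclass x * qclass y.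
Proof. by rewrite -qmulE. Qed.

Lemma qclassN x : qclass (rs_opp x) = - qclass x.
Proof. by rewrite -qoppE. Qed.

Lemma qclass0 : qclass (@rs_zero S) = 0.
Proof. by []. Qed.

Lemma qclass1 : qclass (@rs_one S) = 1.
Proof. by []. Qed.
End QuotientRing.

Section ProductRing.
Variables (I : Type) (R : I -> comPzRingType).

Definition prod_ring : Type := forall i, R i.

HB.instance Definition _ := gen_eqMixin prod_ring.
HB.instance Definition _ := gen_choiceMixin prod_ring.

Definition pr_zero : prod_ring := fun=> 0.
Definition pr_one : prod_ring := fun=> 1.
Definition pr_opp (f : prod_ring) : prod_ring := fun i => - f i.
Definition pr_add (f g : prod_ring) : prod_ring := fun i => f i + g i.
Definition pr_mul (f g : prod_ring) : prod_ring := fun i => f i * g i.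

Lemma pr_addA : associative pr_add.
Proof. by move=> f g h; apply: functional_extensionality_dep => i; apply: addrA. Qed.
Lemma pr_addC : commutative pr_add.
Proof. by move=> f g; apply: functional_extensionality_dep => i; apply: addrC. Qed.
Lemma pr_add0 : left_id pr_zero pr_add.
Proof. by move=> f; apply: functional_extensionality_dep => i; apply: add0r. Qed.
Lemma pr_addN : left_inverse pr_zero pr_opp pr_add.
Proof. by move=> f; apply: functional_extensionality_dep => i; apply: addNr. Qed.

HB.instance Definition _ :=
  GRing.isZmodule.Build prod_ring pr_addA pr_addC pr_add0 pr_addN.

Lemma pr_mulA : associative pr_mul.
Proof. by move=> f g h; apply: functional_extensionality_dep => i; apply: mulrA. Qed.
Lemma pr_mulC : commutative pr_mul.
Proof. by move=> f g; apply: functional_extensionality_dep => i; apply: mulrC. Qed.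
Lemma pr_mul1 : left_id pr_one pr_mul.
Proof. by move=> f; apply: functional_extensionality_dep => i; apply: mul1r. Qed.
Lemma pr_mulDl : left_distributive pr_mul pr_add.
Proof. by move=> f g h; apply: functional_extensionality_dep => i; apply: mulrDl. Qed.

HB.instance Definition _ :=
  GRing.Zmodule_isComPzRing.Build prod_ring pr_mulA pr_mulC pr_mul1 pr_mulDl.
End ProductRing.

Record opens (X : topologicalType) := Opens {
  oset :> set X;
  openP : open oset }.

Lemma opens_ext (X : topologicalType) (U V : opens X) :
  (U : set X) = V -> U = V.
Proof.
case: U V => U oU [V oV] /= UV; subst V.
by rewrite (Prop_irrelevance oU oV).
Qed.

Definition oI (X : topologicalType) (U V : opens X) : opens X :=
  Opens (openI (openP U) (openP V)).

Definition oT (X : topologicalType) : opens X := Opens (@openT X).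

Lemma open_preimage (X Y : topologicalType) (f : X -> Y) (V : set Y) :
  continuous f -> open V -> open (f @^-1` V).
Proof. by move=> /continuousP; apply. Qed.

Definition opre (X Y : topologicalType) (f : X -> Y) (cf : continuous f)
    (V : opens Y) : opens X :=
  Opens (open_preimage cf (openP V)).

Lemma opre_sub (X Y : topologicalType) (f : X -> Y) (cf : continuous f)
    (V : opens Y) : opre cf V `<=` f @^-1` V.
Proof. by []. Qed.

Record ringedSpace := RingedSpace {
  space :> topologicalType;
  sheaf : opens space -> comPzRingType;
  res : forall U V : opens space,
    V `<=` U -> {rmorphism sheaf U -> sheaf V};
  res_id : forall (U : opens space) (h : U `<=` U) s, res h s = s;
  res_comp : forall (U V W : opens space)
    (hV : V `<=` U) (hW : W `<=` V) (hWU : W `<=` U) s,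
    res hW (res hV s) = res hWU s;
  sheafP : forall (U : opens space) (I : Type) (V : I -> opens space)
    (hV : forall i, V i `<=` U),
    U `<=` \bigcup_i V i ->
    forall s : forall i, sheaf (V i),
    (forall i j (W : opens space) (hi : W `<=` V i) (hj : W `<=` V j),
       res hi (s i) = res hj (s j)) ->
    exists! t : sheaf U, forall i, res (hV i) t = s i }.

Arguments sheaf : clear implicits.
Arguments res X [U V] : rename.

Section Stalk.
Variables (X : ringedSpace) (x : X).

Record germ_rep := GermRep {
  gr_open : opens X;
  gr_in : oset gr_open x;
  gr_sec : sheaf X gr_open }.

Definition germ_eq (a b : germ_rep) : Prop :=
  exists (W : opens X) (ha : W `<=` gr_open a) (hb : W `<=` gr_open b),
    oset W x /\ res X ha (gr_sec a) = res X hb (gr_sec b).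

Let hl (U V : opens X) : oI U V `<=` U := @subIsetl _ U V.
Let hr (U V : opens X) : oI U V `<=` V := @subIsetr _ U V.

Definition germ_op2 (op : forall R : comPzRingType, R -> R -> R)
    (a b : germ_rep) : germ_rep :=
  @GermRep (oI (gr_open a) (gr_open b)) (conj (gr_in a) (gr_in b))
    (op _ (res X (@hl _ _) (gr_sec a)) (res X (@hr _ _) (gr_sec b))).

Definition germ_opp (a : germ_rep) : germ_rep :=
  GermRep (gr_in a) (- gr_sec a).

Definition germ_cst (c : forall R : comPzRingType, R) : germ_rep :=
  @GermRep (oT X) Logic.I (c _).

Lemma germ_eq_refl a : germ_eq a a.
Proof.
exists (gr_open a), (@subset_refl _ _), (@subset_refl _ _).
by split=> //; apply: gr_in.
Qed.

Lemma germ_eq_sym a b : germ_eq a b -> germ_eq b a.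
Proof. by move=> [W [ha [hb [Wx e]]]]; exists W, hb, ha. Qed.

Lemma germ_eq_trans b a c : germ_eq a b -> germ_eq b c -> germ_eq a c.
Proof.
move=> [W [ha [hb [Wx e]]]] [W' [hb' [hc [Wx' e']]]].
exists (oI W W'), (subset_trans (@hl W W') ha), (subset_trans (@hr W W') hc).
split=> //.
rewrite -(res_comp ha (@hl W W')) e (res_comp _ _ (subset_trans (@hr W W') hb')).
by rewrite -(res_comp hb' (@hr W W')) e' (res_comp _ _ (subset_trans (@hr W W') hc)).
Qed.

Lemma germ_eqI (W : opens X) a b
    (ha : W `<=` gr_open a) (hb : W `<=` gr_open b) :
  oset W x -> res X ha (gr_sec a) = res X hb (gr_sec b) -> germ_eq a b.
Proof. by move=> Wx e; exists W, ha, hb. Qed.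

Lemma germ_op2P (op : forall R : comPzRingType, R -> R -> R) :
  (forall (R S : comPzRingType) (f : {rmorphism R -> S}) u v,
     f (op R u v) = op S (f u) (f v)) ->
  forall a a' b b', germ_eq a a' -> germ_eq b b' ->
    germ_eq (germ_op2 op a b) (germ_op2 op a' b').
Proof.
move=> fop a a' b b' [W [ha [ha' [Wx e]]]] [V [hb [hb' [Vx e']]]].
have h : oI W V `<=` gr_open (germ_op2 op a b).
  by move=> y [Wy Vy]; split; [exact: (ha _ Wy)|exact: (hb _ Vy)].
have h' : oI W V `<=` gr_open (germ_op2 op a' b').
  by move=> y [Wy Vy]; split; [exact: (ha' _ Wy)|exact: (hb' _ Vy)].
apply: (germ_eqI (ha := h) (hb := h')) => //=; rewrite !fop.
rewrite !(res_comp _ _ (subset_trans (@hl W V) ha)).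
rewrite !(res_comp _ _ (subset_trans (@hr W V) hb)).
rewrite !(res_comp _ _ (subset_trans (@hl W V) ha')).
rewrite !(res_comp _ _ (subset_trans (@hr W V) hb')).
rewrite -(res_comp ha (@hl W V)) -(res_comp hb (@hr W V)) e e'.
by rewrite (res_comp ha' (@hl W V) (subset_trans (@hl W V) ha'))
  (res_comp hb' (@hr W V) (subset_trans (@hr W V) hb')).
Qed.

Let addop := fun (R : comPzRingType) (u v : R) => u + v.
Let mulop := fun (R : comPzRingType) (u v : R) => u * v.
Let addf (R S : comPzRingType) (f : {rmorphism R -> S}) u v :
  f (addop u v) = addop (f u) (f v) := rmorphD f u v.
Let mulf (R S : comPzRingType) (f : {rmorphism R -> S}) u v :
  f (mulop u v) = mulop (f u) (f v) := rmorphM f u v.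

Lemma germ_oppP a a' : germ_eq a a' -> germ_eq (germ_opp a) (germ_opp a').
Proof.
by move=> [W [ha [ha' [Wx e]]]]; exists W, ha, ha'; split=> //=; rewrite !rmorphN e.
Qed.

Lemma resE (X0 : ringedSpace) (U V W : opens X0) (hV : V `<=` U) (hW : W `<=` V) s :
  res X0 hW (res X0 hV s) = res X0 (subset_trans hW hV) s.
Proof. exact: res_comp. Qed.

Lemma res_irr (X0 : ringedSpace) (U V : opens X0) (h h' : V `<=` U) s :
  res X0 h s = res X0 h' s.
Proof. by rewrite (Prop_irrelevance h h'). Qed.

Let gadd := germ_op2 addop.
Let gmul := germ_op2 mulop.
Let gzero := germ_cst (fun R => 0).
Let gone := germ_cst (fun R => 1).

Local Ltac germ_tac :=
  rewrite /= /addop /mulop ?(rmorphD, rmorphM, rmorphN, rmorph0, rmorph1);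
  rewrite ?(rmorphD, rmorphM, rmorphN, rmorph0, rmorph1) ?resE.

Lemma germ_addA a b c : germ_eq (gadd a (gadd b c)) (gadd (gadd a b) c).
Proof.
have h : gr_open (gadd a (gadd b c)) `<=` gr_open (gadd (gadd a b) c).
  by move=> y [? []].
apply: (germ_eqI (ha := @subset_refl _ _) (hb := h)); first exact: gr_in.
by germ_tac; rewrite addrA; do 2?congr (_ + _); apply: res_irr.
Qed.

Lemma germ_mulA a b c : germ_eq (gmul a (gmul b c)) (gmul (gmul a b) c).
Proof.
have h : gr_open (gmul a (gmul b c)) `<=` gr_open (gmul (gmul a b) c).
  by move=> y [? []].
apply: (germ_eqI (ha := @subset_refl _ _) (hb := h)); first exact: gr_in.
by germ_tac; rewrite mulrA; do 2?congr (_ * _); apply: res_irr.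
Qed.

Lemma germ_addC a b : germ_eq (gadd a b) (gadd b a).
Proof.
have h : gr_open (gadd a b) `<=` gr_open (gadd b a) by move=> y [].
apply: (germ_eqI (ha := @subset_refl _ _) (hb := h)); first exact: gr_in.
by germ_tac; rewrite addrC; congr (_ + _); apply: res_irr.
Qed.

Lemma germ_mulC a b : germ_eq (gmul a b) (gmul b a).
Proof.
have h : gr_open (gmul a b) `<=` gr_open (gmul b a) by move=> y [].
apply: (germ_eqI (ha := @subset_refl _ _) (hb := h)); first exact: gr_in.
by germ_tac; rewrite mulrC; congr (_ * _); apply: res_irr.
Qed.

Lemma germ_add0 a : germ_eq (gadd gzero a) a.
Proof.
have h : gr_open (gadd gzero a) `<=` gr_open a by move=> y [].
apply: (germ_eqI (ha := @subset_refl _ _) (hb := h)); first exact: gr_in.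
by germ_tac; rewrite add0r; apply: res_irr.
Qed.

Lemma germ_mul1 a : germ_eq (gmul gone a) a.
Proof.
have h : gr_open (gmul gone a) `<=` gr_open a by move=> y [].
apply: (germ_eqI (ha := @subset_refl _ _) (hb := h)); first exact: gr_in.
by germ_tac; rewrite mul1r; apply: res_irr.
Qed.

Lemma germ_addN a : germ_eq (gadd (germ_opp a) a) gzero.
Proof.
have h : gr_open (gadd (germ_opp a) a) `<=` gr_open gzero by [].
apply: (germ_eqI (ha := @subset_refl _ _) (hb := h)); first exact: gr_in.
germ_tac; rewrite [X in _ + X](_ : _ = res X (subset_trans (@subset_refl _ _)
  (@hl (gr_open a) (gr_open a))) (gr_sec a)) ?addNr //.
exact: res_irr.
Qed.

Lemma germ_mulDl a b c :
  germ_eq (gmul (gadd a b) c) (gadd (gmul a c) (gmul b c)).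
Proof.
have h : gr_open (gmul (gadd a b) c) `<=` gr_open (gadd (gmul a c) (gmul b c)).
  by move=> y [[? ?] ?].
apply: (germ_eqI (ha := @subset_refl _ _) (hb := h)); first exact: gr_in.
by germ_tac; rewrite mulrDl; congr (_ * _ + _ * _); apply: res_irr.
Qed.

Definition germ_setoid : ring_setoid :=
  RingSetoid (rs_zero := gzero) (rs_one := gone)
    germ_eq_refl germ_eq_sym germ_eq_trans
    germ_oppP (germ_op2P addf) (germ_op2P mulf)
    germ_addA germ_addC germ_add0 germ_addN
    germ_mulA germ_mulC germ_mul1 germ_mulDl.

Definition stalk : comPzRingType := qring germ_setoid.

Definition germ (U : opens X) (Ux : oset U x) (s : sheaf X U) : stalk :=
  qclass (GermRep Ux s : germ_setoid).

Lemma stalk_ind (P : stalk -> Prop) :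
  (forall (U : opens X) (Ux : oset U x) s, P (germ Ux s)) -> forall a, P a.
Proof. by move=> Pg; elim/qring_ind => -[U Ux s]; apply: Pg. Qed.

Lemma germP (U V : opens X) (Ux : oset U x) (Vx : oset V x) s t :
  germ Ux s = germ Vx t <->
  exists (W : opens X) (hU : W `<=` U) (hV : W `<=` V),
    oset W x /\ res X hU s = res X hV t.
Proof. exact: qclassP. Qed.

Lemma germ_res (U V : opens X) (Ux : oset U x) (Vx : oset V x)
    (h : V `<=` U) s : germ Vx (res X h s) = germ Ux s.
Proof.
apply/germP; exists V, (@subset_refl _ _), h; split=> //.
by rewrite resE; apply: res_irr.
Qed.

Lemma germD (U : opens X) (Ux : oset U x) s t :
  germ Ux (s + t) = germ Ux s + germ Ux t.
Proof.
rewrite -qclassD; apply/germP.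
have h : U `<=` oI U U by [].
exists U, (@subset_refl _ _), h; split=> //.
by germ_tac; congr (_ + _); apply: res_irr.
Qed.

Lemma germM (U : opens X) (Ux : oset U x) s t :
  germ Ux (s * t) = germ Ux s * germ Ux t.
Proof.
rewrite -qclassM; apply/germP.
have h : U `<=` oI U U by [].
exists U, (@subset_refl _ _), h; split=> //.
by germ_tac; congr (_ * _); apply: res_irr.
Qed.

Lemma germN (U : opens X) (Ux : oset U x) s : germ Ux (- s) = - germ Ux s.
Proof. by rewrite -qclassN. Qed.

Lemma germ1 (U : opens X) (Ux : oset U x) : germ Ux 1 = 1.
Proof.
apply/germP; exists U, (@subset_refl _ _), (@subsetT _ _); split=> //.
by rewrite !rmorph1.
Qed.

Lemma germ0 (U : opens X) (Ux : oset U x) : germ Ux 0 = 0.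
Proof. by rewrite -[0 in LHS](subrr 1) germD germN subrr. Qed.

Lemma stalk_ind2 (P : stalk -> stalk -> Prop) :
  (forall (U : opens X) (Ux : oset U x) s t, P (germ Ux s) (germ Ux t)) ->
  forall a b, P a b.
Proof.
move=> Pg; elim/stalk_ind => U Ux s; elim/stalk_ind => V Vx t.
have UVx : oset (oI U V) x by [].
by rewrite -(germ_res Ux UVx (@hl U V)) -(germ_res Vx UVx (@hr U V)).
Qed.
End Stalk.

Arguments stalk : clear implicits.

Record rsMor (X Y : ringedSpace) := RSMor {
  rs_map :> X -> Y;
  rs_cont : continuous rs_map;
  (* The morphism of sheaves O_Y -> f_* O_X, composed with restrictions: it is
     indexed by all pairs of open sets such that f(U) is included in V, which
     avoids transports between f^-1 (g^-1 W) and (g \o f)^-1 W. *)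
  pull : forall (V : opens Y) (U : opens X),
    U `<=` rs_map @^-1` V -> {rmorphism sheaf Y V -> sheaf X U};
  pull_res : forall (V V' : opens Y) (U U' : opens X)
    (h : U `<=` rs_map @^-1` V) (h' : U' `<=` rs_map @^-1` V')
    (hV : V' `<=` V) (hU : U' `<=` U) s,
    res X hU (pull h s) = pull h' (res Y hV s) }.

Arguments pull {X Y} f [V U] h : rename.

Lemma rsMor_ext (X Y : ringedSpace) (f g : rsMor X Y) :
  (forall x, f x = g x) ->
  (forall (V : opens Y) (U : opens X) (hf : U `<=` f @^-1` V)
     (hg : U `<=` g @^-1` V) s, pull f hf s = pull g hg s) ->
  f = g.
Proof.
case: f g => f cf pf rf [g cg pg rg] /= /funext fg; subst g => pfg.
have {}pfg : pf = pg.
  apply: functional_extensionality_dep => V.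
  apply: functional_extensionality_dep => U.
  apply: functional_extensionality_dep => h.
  by apply: rmorphism_ext => s; apply: pfg.
by subst pg; rewrite (Prop_irrelevance cf cg) (Prop_irrelevance rf rg).
Qed.

Section StalkMap.
Variables (X Y : ringedSpace) (f : rsMor X Y) (x : X).

Definition stalk_fun (a : stalk Y (f x)) : stalk X x :=
  let g := qrepr a in
  @germ X x (opre (@rs_cont _ _ f) (gr_open g)) (gr_in g)
    (pull f (@opre_sub _ _ _ (@rs_cont _ _ f) _) (gr_sec g)).

Lemma stalk_fun_germ (V : opens Y) (U : opens X) (Vfx : oset V (f x))
    (Ux : oset U x) (h : U `<=` f @^-1` V) s :
  stalk_fun (germ Vfx s) = germ Ux (pull f h s).
Proof.
rewrite /stalk_fun; set g := qrepr _.
have [W [hg [hV [Wfx e]]]] : germ_eq g (GermRep Vfx s) :=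
  @qrepr_eq (germ_setoid (f x)) (GermRep Vfx s).
apply/germP.
have h1 : oI (opre (@rs_cont _ _ f) W) U `<=` opre (@rs_cont _ _ f) (gr_open g).
  by move=> y [] /= /hg.
have h2 : oI (opre (@rs_cont _ _ f) W) U `<=` U by move=> y [].
exists (oI (opre (@rs_cont _ _ f) W) U), h1, h2; split=> //.
have h3 : oI (opre (@rs_cont _ _ f) W) U `<=` f @^-1` W by move=> y [].
by rewrite (pull_res _ h3 hg) (pull_res _ h3 hV) e.
Qed.

Let pre_germ (V : opens Y) (Vfx : oset V (f x)) s :
  stalk_fun (germ Vfx s) =
  @germ X x (opre (@rs_cont _ _ f) V) Vfx (pull f (@opre_sub _ _ _ (@rs_cont _ _ f) _) s) :=
  stalk_fun_germ _ _ _ _.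

Lemma stalk_funB a b : stalk_fun (a - b) = stalk_fun a - stalk_fun b.
Proof.
elim/stalk_ind2: a / b => V Vfx s t.
by rewrite -germN -germD !pre_germ rmorphB germD germN.
Qed.

Lemma stalk_funM a b : stalk_fun (a * b) = stalk_fun a * stalk_fun b.
Proof.
elim/stalk_ind2: a / b => V Vfx s t.
by rewrite -germM !pre_germ rmorphM germM.
Qed.

Lemma stalk_fun1 : stalk_fun 1 = 1.
Proof.
have Tfx : oset (oT Y) (f x) by [].
by rewrite -(germ1 Tfx) pre_germ rmorph1 germ1.
Qed.

Definition stalk_map : {rmorphism stalk Y (f x) -> stalk X x} :=
  mk_rmorphism stalk_funB stalk_fun1 stalk_funM.

Lemma stalk_map_germ (V : opens Y) (U : opens X) (Vfx : oset V (f x))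
    (Ux : oset U x) (h : U `<=` f @^-1` V) s :
  stalk_map (germ Vfx s) = germ Ux (pull f h s).
Proof. exact: stalk_fun_germ. Qed.
End StalkMap.

(* comPzRingType carries no notion of unit. *)
Definition is_unit (R : comPzRingType) (a : R) : Prop := exists b, a * b = 1.

Definition local_ring (R : comPzRingType) : Prop :=
  (1 : R) <> 0 /\
  forall a b : R, ~ is_unit a -> ~ is_unit b -> ~ is_unit (a + b).

Definition local_hom (R S : comPzRingType) (f : R -> S) : Prop :=
  forall a, is_unit (f a) -> is_unit a.

Lemma is_unit_rmorph (R S : comPzRingType) (f : {rmorphism R -> S}) a :
  is_unit a -> is_unit (f a).
Proof. by move=> [b ab]; exists (f b); rewrite -rmorphM ab rmorph1. Qed.

Record lrSpace := LRSpace {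
  lr_rs :> ringedSpace;
  lr_local : forall x : lr_rs, local_ring (stalk lr_rs x) }.

Record lrMor (X Y : lrSpace) := LRMor {
  lr_mor :> rsMor X Y;
  lr_mor_local : forall x, local_hom (stalk_map lr_mor x) }.

Lemma lrMor_ext (X Y : lrSpace) (f g : lrMor X Y) :
  (forall x, f x = g x) ->
  (forall (V : opens Y) (U : opens X) (hf : U `<=` f @^-1` V)
     (hg : U `<=` g @^-1` V) s, pull f hf s = pull g hg s) ->
  f = g.
Proof.
move=> fg pfg; have e : (f : rsMor X Y) = g by apply: rsMor_ext.
case: f g e {fg pfg} => f lf [g lg] /= e; subst g.
by rewrite (Prop_irrelevance lf lg).
Qed.

Section Identity.
Variable X : ringedSpace.

Lemma id_continuous : continuous (fun x : X => x).
Proof. by move=> x A. Qed.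

Definition rs_idmap : rsMor X X.
Proof.
refine (@RSMor X X (fun x => x) id_continuous
  (fun V U (h : U `<=` _ @^-1` V) => res X (h : U `<=` V)) _).
by move=> V V' U U' h h' hV hU s; rewrite !resE; apply: res_irr.
Defined.

Lemma stalk_map_id x a : stalk_map rs_idmap x a = a.
Proof.
elim/stalk_ind: a => U Ux s.
rewrite (stalk_map_germ (f := rs_idmap) Ux Ux (@subset_refl _ _)).
exact: germ_res.
Qed.
End Identity.

Section Composition.
Variables (X Y Z : ringedSpace) (g : rsMor Y Z) (f : rsMor X Y).

Lemma comp_continuous : continuous (fun x => g (f x)).
Proof. by move=> x; apply: continuous_comp; apply: rs_cont. Qed.

Definition comp_pull (W : opens Z) (U : opens X)
    (h : U `<=` (fun x => g (f x)) @^-1` W) :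
    {rmorphism sheaf Z W -> sheaf X U} :=
  pull f (h : U `<=` f @^-1` opre (@rs_cont _ _ g) W)
    \o pull g (@opre_sub _ _ _ (@rs_cont _ _ g) W).

Definition rs_comp : rsMor X Z.
Proof.
refine (@RSMor X Z (fun x => g (f x)) comp_continuous comp_pull _).
move=> V V' U U' h h' hV hU s; rewrite /comp_pull /=.
have hg : opre (@rs_cont _ _ g) V' `<=` opre (@rs_cont _ _ g) V.
  by move=> y /= /hV.
rewrite (pull_res _ (h' : U' `<=` f @^-1` opre (@rs_cont _ _ g) V') hg).
by rewrite (pull_res _ (@opre_sub _ _ _ (@rs_cont _ _ g) V') hV).
Defined.

Lemma stalk_map_comp x a :
  stalk_map rs_comp x a = stalk_map f x (stalk_map g (f x) a).
Proof.
elim/stalk_ind: a => W Wx s.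
pose V := opre (@rs_cont _ _ g) W; pose U := opre (@rs_cont _ _ f) V.
have Vx : oset V (f x) by [].
have Ux : oset U x by [].
have hU : U `<=` f @^-1` V by [].
rewrite (@stalk_map_germ _ _ g (f x) W V Wx Vx (@opre_sub _ _ _ _ _)).
rewrite (@stalk_map_germ _ _ f x V U Vx Ux hU).
exact: (@stalk_map_germ _ _ rs_comp x W U Wx Ux hU).
Qed.
End Composition.

Lemma lr_id_local (X : lrSpace) x : local_hom (stalk_map (rs_idmap X) x).
Proof. by move=> a; rewrite stalk_map_id. Qed.

Definition lr_id (X : lrSpace) : lrMor X X := LRMor (@lr_id_local X).

Lemma lr_comp_local (X Y Z : lrSpace) (g : lrMor Y Z) (f : lrMor X Y) x :
  local_hom (stalk_map (rs_comp g f) x).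
Proof.
by move=> a; rewrite stalk_map_comp => /lr_mor_local/lr_mor_local.
Qed.

Definition lr_comp (X Y Z : lrSpace) (g : lrMor Y Z) (f : lrMor X Y) :
  lrMor X Z := LRMor (@lr_comp_local X Y Z g f).

Lemma pull_irr (X Y : ringedSpace) (f : rsMor X Y) (V : opens Y) (U : opens X)
  (h h' : U `<=` f @^-1` V) s : pull f h s = pull f h' s.
Proof. by rewrite (Prop_irrelevance h h'). Qed.

Lemma lr_compA (X Y Z T : lrSpace) (h : lrMor Z T) (g : lrMor Y Z)
    (f : lrMor X Y) : lr_comp h (lr_comp g f) = lr_comp (lr_comp h g) f.
Proof.
apply: lrMor_ext => // V U hf hg s; rewrite /= /comp_pull /= /comp_pull /=.
have e : opre (@comp_continuous Y Z T h g) V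
  `<=` opre (@rs_cont _ _ g) (opre (@rs_cont _ _ h) V) by [].
rewrite -[LHS](res_id (@subset_refl _ _)).
rewrite (@pull_res _ _ f _ _ _ _ _ (hg : U `<=` f @^-1` _) e).
rewrite (@pull_res _ _ g _ _ _ _ _ e (@subset_refl _ _)) res_id.
by rewrite (Prop_irrelevance e (@opre_sub _ _ _ (@comp_continuous Y Z T h g) V)).
Qed.

Lemma lr_comp1m (X Y : lrSpace) (f : lrMor X Y) : lr_comp (lr_id Y) f = f.
Proof.
apply: lrMor_ext => // V U hf hg s; rewrite /= /comp_pull /=.
have hV : opre (@id_continuous Y) V `<=` V by [].
rewrite -[RHS](res_id (@subset_refl _ _)).
rewrite (@pull_res _ _ f _ (opre (@id_continuous Y) V) _ _ hg
  (hf : U `<=` f @^-1` _) hV).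
by rewrite (Prop_irrelevance hV (@opre_sub _ _ _ (@id_continuous Y) V)).
Qed.

Lemma lr_compm1 (X Y : lrSpace) (f : lrMor X Y) : lr_comp f (lr_id X) = f.
Proof.
apply: lrMor_ext => // V U hf hg s; rewrite /= /comp_pull /=.
rewrite (@pull_res _ _ f V V _ U (@opre_sub _ _ _ (@rs_cont _ _ f) V) hg
  (@subset_refl _ V)).
by rewrite res_id.
Qed.

Definition lr_iso (X Y : lrSpace) (f : lrMor X Y) : Prop :=
  exists g : lrMor Y X, lr_comp g f = lr_id X /\ lr_comp f g = lr_id Y.

(* A homeomorphism onto an open subset f(X), inducing an isomorphism between
   the restriction of O_Y to f(X) and O_X. *)
Definition open_immersion (X Y : ringedSpace) (f : rsMor X Y) : Prop :=
  [/\ injective f,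
      forall U : opens X, open (f @` U) &
      forall (V : opens Y) (U : opens X) (h : U `<=` f @^-1` V),
        (V : set Y) = f @` U -> bijective (pull f h)].

Record primeIdeal (A : comPzRingType) := PrimeIdeal {
  pset :> set A;
  prime0 : pset 0;
  primeD : forall a b, pset a -> pset b -> pset (a + b);
  primeMr : forall a b, pset b -> pset (a * b);
  prime1 : ~ pset 1;
  primeM : forall a b, pset (a * b) -> pset a \/ pset b }.

Section Localization.
Variables (A : comPzRingType) (p : primeIdeal A).

Record frac_rep := FracRep { fr_num : A; fr_den : A; fr_denP : ~ pset p fr_den }.

Lemma nprimeM a b : ~ pset p a -> ~ pset p b -> ~ pset p (a * b).
Proof. by move=> na nb /primeM[]. Qed.

Definition frac_eq (x y : frac_rep) : Prop :=
  exists2 t, ~ pset p t & t * (fr_num x * fr_den y) = t * (fr_num y * fr_den x).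

Definition frac_zero := FracRep 0 (@prime1 _ p).
Definition frac_one := FracRep 1 (@prime1 _ p).
Definition frac_opp x := FracRep (- fr_num x) (@fr_denP x).
Definition frac_add x y :=
  FracRep (fr_num x * fr_den y + fr_num y * fr_den x)
    (nprimeM (@fr_denP x) (@fr_denP y)).
Definition frac_mul x y :=
  FracRep (fr_num x * fr_num y) (nprimeM (@fr_denP x) (@fr_denP y)).

Lemma frac_eqE x y : fr_num x * fr_den y = fr_num y * fr_den x -> frac_eq x y.
Proof. by move=> e; exists 1; [exact: prime1|rewrite e]. Qed.

Lemma frac_eq_refl x : frac_eq x x.
Proof. exact: frac_eqE. Qed.

Lemma frac_eq_sym x y : frac_eq x y -> frac_eq y x.
Proof. by move=> [t nt e]; exists t. Qed.

Lemma frac_eq_trans y x z : frac_eq x y -> frac_eq y z -> frac_eq x z.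
Proof.
case: x y z => a d pd [b e pe] [c f pf] [/= t nt h] [/= u nu k].
exists (t * u * e) => /=; first by do 2?apply: nprimeM.
have -> : t * u * e * (a * f) = u * f * (t * (a * e)) by ring.
rewrite h (_ : _ * _ = t * d * (u * (b * f))); last by ring.
by rewrite k; ring.
Qed.

Lemma frac_oppP x x' : frac_eq x x' -> frac_eq (frac_opp x) (frac_opp x').
Proof. by move=> [t nt h]; exists t => //=; rewrite !mulNr !mulrN h. Qed.

Lemma frac_addP x x' y y' : frac_eq x x' -> frac_eq y y' ->
  frac_eq (frac_add x y) (frac_add x' y').
Proof.
case: x x' y y' => a d pd [a' d' pd'] [b e pe] [b' e' pe'].
move=> [/= t nt h] [/= u nu k].
exists (t * u) => /=; first exact: nprimeM.
have -> : t * u * ((a * e + b * d) * (d' * e')) =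
  u * e * e' * (t * (a * d')) + t * d * d' * (u * (b * e')) by ring.
by rewrite h k; ring.
Qed.

Lemma frac_mulP x x' y y' : frac_eq x x' -> frac_eq y y' ->
  frac_eq (frac_mul x y) (frac_mul x' y').
Proof.
case: x x' y y' => a d pd [a' d' pd'] [b e pe] [b' e' pe'].
move=> [/= t nt h] [/= u nu k].
exists (t * u) => /=; first exact: nprimeM.
have -> : t * u * (a * b * (d' * e')) =
  (t * (a * d')) * (u * (b * e')) by ring.
by rewrite h k; ring.
Qed.

Definition frac_setoid : ring_setoid.
Proof.
refine (@RingSetoid frac_rep frac_eq frac_zero frac_one frac_opp frac_add
  frac_mul frac_eq_refl frac_eq_sym frac_eq_trans frac_oppP frac_addP frac_mulP
  _ _ _ _ _ _ _ _); move=> *; apply: frac_eqE => /=; ring.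
Defined.

Definition localization : comPzRingType := qring frac_setoid.

Definition frac (a d : A) (pd : ~ pset p d) : localization :=
  qclass (FracRep a pd : frac_setoid).

Lemma fracP a d (pd : ~ pset p d) b e (pe : ~ pset p e) :
  frac a pd = frac b pe <-> exists2 t, ~ pset p t & t * (a * e) = t * (b * d).
Proof. exact: qclassP. Qed.

Lemma fracE a d (pd : ~ pset p d) b e (pe : ~ pset p e) :
  a * e = b * d -> frac a pd = frac b pe.
Proof. by move=> h; apply/fracP; exists 1; [exact: prime1|rewrite h]. Qed.

Lemma localization_ind (P : localization -> Prop) :
  (forall a d (pd : ~ pset p d), P (frac a pd)) -> forall x, P x.
Proof. by move=> Pf; elim/qring_ind => -[a d pd]; apply: Pf. Qed.

Lemma fracD a d (pd : ~ pset p d) b e (pe : ~ pset p e) :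
  frac a pd + frac b pe = frac (a * e + b * d) (nprimeM pd pe).
Proof. by rewrite -qclassD. Qed.

Lemma fracM a d (pd : ~ pset p d) b e (pe : ~ pset p e) :
  frac a pd * frac b pe = frac (a * b) (nprimeM pd pe).
Proof. by rewrite -qclassM. Qed.

Lemma fracN a d (pd : ~ pset p d) : - frac a pd = frac (- a) pd.
Proof. by rewrite -qclassN. Qed.

Lemma frac1 : frac 1 (@prime1 _ p) = 1.
Proof. by []. Qed.

Lemma frac0 : frac 0 (@prime1 _ p) = 0.
Proof. by []. Qed.
End Localization.

Section SpecTopology.
Variable A : comPzRingType.

Definition spec_point : Type := primeIdeal A.
HB.instance Definition _ := gen_eqMixin spec_point.
HB.instance Definition _ := gen_choiceMixin spec_point.

(* The Zariski topology: the sets D(f) form a base. *)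
Definition basic_open (f : A) : set spec_point := [set p | ~ pset p f].

Definition zariski_open : set_system spec_point :=
  [set U | forall p, U p -> exists2 f, basic_open f p & basic_open f `<=` U].

Lemma zariski_openT : zariski_open setT.
Proof. by move=> p _; exists 1 => //; apply: prime1. Qed.

Lemma zariski_openI : setI_closed zariski_open.
Proof.
move=> U V oU oV p [/oU[f fp fU] /oV[g gp gV]].
exists (f * g); first exact: nprimeM.
move=> q /= fgq; split; [apply: fU|apply: gV] => /= h; apply: fgq.
  by rewrite mulrC; apply: primeMr.
exact: primeMr.
Qed.

Lemma zariski_open_bigU (I : Type) (U : I -> set spec_point) :
  (forall i, zariski_open (U i)) -> zariski_open (\bigcup_i U i).
Proof.
move=> oU p [i _ /(oU i)[f fp fU]]; exists f => // q /fU Uq.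
by exists i.
Qed.

HB.instance Definition _ := isOpenTopological.Build spec_point
  zariski_openT zariski_openI zariski_open_bigU.

Definition spec_top : topologicalType := spec_point.

Lemma open_basic f : open (basic_open f : set spec_top).
Proof. by move=> p fp; exists f. Qed.

Lemma spec_openP (U : set spec_top) : open U <->
  forall p, U p -> exists2 f, basic_open f p & basic_open f `<=` U.
Proof. by []. Qed.
End SpecTopology.

Section SpecSections.
Variables (A : comPzRingType) (U : opens (spec_top A)).

Definition spec_fun : comPzRingType :=
  @prod_ring {p : spec_top A | oset U p} (fun q => localization (sval q)).

Definition locally_fraction (s : spec_fun) : Prop :=
  forall q : {p : spec_top A | oset U p},
  exists V : opens (spec_top A), [/\ oset V (sval q), V `<=` U &
    exists a d : A, forall r : {p : spec_top A | oset U p}, oset V (sval r) ->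
      exists dr : ~ pset (sval r) d, s r = frac a dr].

Definition locally_fractionb : spec_fun -> bool :=
  fun s => `[< locally_fraction s >].

Lemma locally_fraction_subring : subring_closed locally_fractionb.
Proof.
split.
- apply/asboolP => q; exists U; split=> //; first exact: (svalP q).
  exists 1, 1 => r _; exists (@prime1 _ (sval r)).
  by rewrite frac1.
- move=> s t /asboolP hs /asboolP ht; apply/asboolP => q.
  have [V [Vq VU [a [d hV]]]] := hs q.
  have [W [Wq WU [b [e hW]]]] := ht q.
  exists (oI V W); split=> //; first by move=> y [/VU].
  exists (a * e - b * d), (d * e) => r [Vr Wr].
  have [dr sr] := hV r Vr; have [er tr] := hW r Wr.
  exists (nprimeM dr er).
  transitivity (s r - t r) => //.
  by rewrite sr tr fracN fracD; apply: fracE; ring.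
- move=> s t /asboolP hs /asboolP ht; apply/asboolP => q.
  have [V [Vq VU [a [d hV]]]] := hs q.
  have [W [Wq WU [b [e hW]]]] := ht q.
  exists (oI V W); split=> //; first by move=> y [/VU].
  exists (a * b), (d * e) => r [Vr Wr].
  have [dr sr] := hV r Vr; have [er tr] := hW r Wr.
  exists (nprimeM dr er).
  transitivity (s r * t r) => //.
  by rewrite sr tr fracM; apply: fracE; ring.
Qed.

HB.instance Definition _ := GRing.isSubringClosed.Build spec_fun
  locally_fractionb locally_fraction_subring.

Record spec_section := SpecSection {
  section_fun : spec_fun;
  section_funP : section_fun \in locally_fractionb }.

HB.instance Definition _ := [isSub for section_fun].
HB.instance Definition _ := [Choice of spec_section by <:].
HB.instance Definition _ :=
  GRing.SubChoice_isSubComPzRing.Build _ _ spec_section (subringClosedP _).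
End SpecSections.

Definition spec_sheaf (A : comPzRingType) (U : opens (spec_top A)) :
  comPzRingType := spec_section U.

Definition spec_val (A : comPzRingType) (U : opens (spec_top A))
    (s : spec_sheaf U) (p : spec_top A) (Up : oset U p) : localization p :=
  section_fun s (exist _ p Up).

Section SpecRingedSpace.
Variable A : comPzRingType.
Local Notation X := (spec_top A).

Lemma spec_ext (U : opens X) (s t : spec_sheaf U) :
  (forall p (Up : oset U p), spec_val s Up = spec_val t Up) -> s = t.
Proof.
move=> st; apply: val_inj; apply: functional_extensionality_dep => -[p Up].
exact: st.
Qed.

Lemma spec_valB (U : opens X) (s t : spec_sheaf U) p (Up : oset U p) :
  spec_val (s - t) Up = spec_val s Up - spec_val t Up.
Proof. by []. Qed.

Lemma spec_valD (U : opens X) (s t : spec_sheaf U) p (Up : oset U p) :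
  spec_val (s + t) Up = spec_val s Up + spec_val t Up.
Proof. by []. Qed.

Lemma spec_valM (U : opens X) (s t : spec_sheaf U) p (Up : oset U p) :
  spec_val (s * t) Up = spec_val s Up * spec_val t Up.
Proof. by []. Qed.

Lemma spec_val1 (U : opens X) p (Up : oset U p) :
  spec_val (1 : spec_sheaf U) Up = 1.
Proof. by []. Qed.

Lemma spec_val0 (U : opens X) p (Up : oset U p) :
  spec_val (0 : spec_sheaf U) Up = 0.
Proof. by []. Qed.

Lemma spec_valP (U : opens X) (s : spec_sheaf U) p (Up : oset U p) :
  exists V : opens X, [/\ oset V p, V `<=` U &
    exists a d : A, forall q (Uq : oset U q), oset V q ->
      exists dq : ~ pset q d, spec_val s Uq = frac a dq].
Proof.
have /asboolP/(_ (exist _ p Up))[V [Vp VU [a [d h]]]] := section_funP s.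
by exists V; split=> //; exists a, d => q Uq /(h (exist _ q Uq)).
Qed.

Lemma mk_spec_sectionP (U : opens X)
    (f : forall p, oset U p -> localization p) :
  (forall p (Up : oset U p),
    exists V : opens X, [/\ oset V p, V `<=` U &
    exists a d : A, forall q (Uq : oset U q), oset V q ->
      exists dq : ~ pset q d, f q Uq = frac a dq]) ->
  (fun q : {p : X | oset U p} => f (sval q) (proj2_sig q))
    \in @locally_fractionb A U.
Proof.
move=> hf; apply/asboolP => -[p Up].
have [V [Vp VU [a [d h]]]] := hf p Up.
by exists V; split=> //; exists a, d => -[q Uq] /= /h.
Qed.

Definition mk_spec_section (U : opens X)
    (f : forall p, oset U p -> localization p) hf : spec_sheaf U :=
  SpecSection (@mk_spec_sectionP U f hf).

Lemma mk_spec_sectionE (U : opens X) f hf p (Up : oset U p) :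
  spec_val (@mk_spec_section U f hf) Up = f p Up.
Proof. by []. Qed.

Lemma spec_res_subproof (U V : opens X) (h : V `<=` U) (s : spec_sheaf U)
    (p : X) (Vp : oset V p) :
  exists W : opens X, [/\ oset W p, W `<=` V &
    exists a d : A, forall q (Vq : oset V q), oset W q ->
      exists dq : ~ pset q d, spec_val s (h q Vq) = frac a dq].
Proof.
have [W [Wp WU [a [d e]]]] := spec_valP s (h p Vp).
exists (oI W V); split=> //; first by move=> y [].
by exists a, d => q Vq [Wq _]; apply: e.
Qed.

Definition spec_res_fun (U V : opens X) (h : V `<=` U) (s : spec_sheaf U) :
  spec_sheaf V := mk_spec_section (spec_res_subproof h s).

Lemma spec_res_funB (U V : opens X) (h : V `<=` U) s t :
  spec_res_fun h (s - t) = spec_res_fun h s - spec_res_fun h t.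
Proof.
by apply: spec_ext => p Vp; rewrite ?spec_valB !mk_spec_sectionE spec_valB.
Qed.

Lemma spec_res_funM (U V : opens X) (h : V `<=` U) s t :
  spec_res_fun h (s * t) = spec_res_fun h s * spec_res_fun h t.
Proof.
by apply: spec_ext => p Vp; rewrite ?spec_valM !mk_spec_sectionE spec_valM.
Qed.

Lemma spec_res_fun1 (U V : opens X) (h : V `<=` U) : spec_res_fun h 1 = 1.
Proof.
by apply: spec_ext => p Vp; rewrite !mk_spec_sectionE spec_val1.
Qed.

Definition spec_res (U V : opens X) (h : V `<=` U) :
    {rmorphism spec_sheaf U -> spec_sheaf V} :=
  mk_rmorphism (spec_res_funB h) (spec_res_fun1 h) (spec_res_funM h).

Lemma spec_resE (U V : opens X) (h : V `<=` U) s p (Vp : oset V p) :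
  spec_val (spec_res h s) Vp = spec_val s (h p Vp).
Proof. by []. Qed.

Lemma spec_val_irr (U : opens X) (s : spec_sheaf U) p (Up Up' : oset U p) :
  spec_val s Up = spec_val s Up'.
Proof. by rewrite (Prop_irrelevance Up Up'). Qed.

Lemma spec_res_id (U : opens X) (h : U `<=` U) s : spec_res h s = s.
Proof. by apply: spec_ext => p Up; rewrite spec_resE; apply: spec_val_irr. Qed.

Lemma spec_res_comp (U V W : opens X) (hV : V `<=` U) (hW : W `<=` V)
  (hWU : W `<=` U) s : spec_res hW (spec_res hV s) = spec_res hWU s.
Proof. by apply: spec_ext => p Wp; rewrite !spec_resE; apply: spec_val_irr. Qed.

Lemma spec_sheafP (U : opens X) (I : Type) (V : I -> opens X)
    (hV : forall i, V i `<=` U) :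
  U `<=` \bigcup_i V i ->
  forall s : forall i, spec_sheaf (V i),
  (forall i j (W : opens X) (hi : W `<=` V i) (hj : W `<=` V j),
     spec_res hi (s i) = spec_res hj (s j)) ->
  exists! t : spec_sheaf U, forall i, spec_res (hV i) t = s i.
Proof.
move=> UV s ss.
have eqs i j p (Vi : oset (V i) p) (Vj : oset (V j) p) :
    spec_val (s i) Vi = spec_val (s j) Vj.
  have hi : oI (V i) (V j) `<=` V i by move=> y [].
  have hj : oI (V i) (V j) `<=` V j by move=> y [].
  have e := ss i j _ hi hj.
  have Vij : oset (oI (V i) (V j)) p by [].
  have e' : spec_val (spec_res hi (s i)) Vij = spec_val (spec_res hj (s j)) Vij.
    by rewrite e.
  move: e'; rewrite !spec_resE => e'.
  by rewrite (spec_val_irr _ Vi (hi p Vij)) e'; apply: spec_val_irr.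
have cov p (Up : oset U p) : {i | oset (V i) p}.
  by apply: cid; have [i _ Vp] := UV p Up; exists i.
pose f p (Up : oset U p) := spec_val (s (sval (cov p Up))) (svalP (cov p Up)).
have fE i p (Vp : oset (V i) p) (Up : oset U p) : f p Up = spec_val (s i) Vp.
  exact: eqs.
have hf p (Up : oset U p) : exists W : opens X, [/\ oset W p, W `<=` U &
    exists a d : A, forall q (Uq : oset U q), oset W q ->
      exists dq : ~ pset q d, f q Uq = frac a dq].
  have [i Vp] := cov p Up; have [W [Wp WV [a [d e]]]] := spec_valP (s i) Vp.
  exists W; split=> //; first exact: subset_trans (hV i).
  exists a, d => q Uq Wq; have [dq sq] := e q (WV q Wq) Wq.
  by exists dq; rewrite (fE i q (WV q Wq)).
exists (mk_spec_section hf); split.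
  move=> i; apply: spec_ext => p Vp; rewrite spec_resE mk_spec_sectionE.
  exact: fE.
move=> t ht; apply: spec_ext => p Up; rewrite mk_spec_sectionE.
have [i Vp] := cov p Up; rewrite (fE i p Vp) -(ht i) spec_resE.
exact: spec_val_irr.
Qed.

Definition spec_rs : ringedSpace :=
  RingedSpace spec_res_id spec_res_comp spec_sheafP.

Lemma spec_frac_subproof (U : opens X) (a d : A)
    (hd : forall p : X, oset U p -> ~ pset p d) (p : X) (Up : oset U p) :
  exists W : opens X, [/\ oset W p, W `<=` U &
    exists b e : A, forall q (Uq : oset U q), oset W q ->
      exists eq : ~ pset q e, frac a (hd q Uq) = frac b eq].
Proof. by exists U; split=> //; exists a, d => q Uq _; exists (hd q Uq). Qed.

Definition spec_frac (U : opens X) (a d : A)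
    (hd : forall p : X, oset U p -> ~ pset p d) : spec_sheaf U :=
  mk_spec_section (spec_frac_subproof a hd).

Lemma spec_stalk_frac (p : spec_rs) (x : stalk spec_rs p) :
  exists (U : opens X) (Up : oset U p) (a d : A)
    (hd : forall q : X, oset U q -> ~ pset q d),
    x = @germ spec_rs p U Up (spec_frac a hd).
Proof.
elim/stalk_ind: x => U Up s.
have [V [Vp VU [a [d e]]]] := @spec_valP U s p Up.
have hd q : oset V q -> ~ pset q d.
  by move=> Vq; have [] := e q (VU q Vq) Vq.
exists V, Vp, a, d, hd; rewrite -(@germ_res spec_rs p U V Up Vp VU).
congr (germ _ _); apply: spec_ext => q Vq.
rewrite spec_resE mk_spec_sectionE.
by have [dq ->] := e q (VU q Vq) Vq; apply: fracE.
Qed.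

Lemma spec_stalk_unit (p : spec_rs) (U : opens X) (Up : oset U p) (a d : A)
    (hd : forall q : X, oset U q -> ~ pset q d) :
  is_unit (@germ spec_rs p U Up (spec_frac a hd)) <-> ~ pset (p : spec_point A) a.
Proof.
split=> [[y]|na].
  have [V [Vp [b [e [he ->]]]]] := spec_stalk_frac y.
  have UVp : oset (oI U V) p by [].
  have hU : oI U V `<=` U by move=> q [].
  have hV : oI U V `<=` V by move=> q [].
  rewrite -(@germ_res spec_rs p _ _ Up UVp hU) -(@germ_res spec_rs p _ _ Vp UVp hV).
  rewrite -germM -(@germ1 spec_rs p _ UVp) => /germP[W [h [h' [Wp E]]]].
  have := congr1 (fun t => @spec_val A W t p Wp) E.
  cbv beta; rewrite !spec_resE spec_valM !spec_resE !mk_spec_sectionE fracM.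
  rewrite -[RHS]frac1 => /fracP[t nt]; rewrite mulr1 mul1r => E' pa.
  suff : pset (p : spec_point A) (t * (d * e)).
    move=> /primeM[//|/primeM[|]]; first exact: (hd p Up).
    exact: (he p Vp).
  by rewrite -E' mulrA mulrC; apply: primeMr; apply: primeMr.
pose V := oI U (Opens (@open_basic A a)).
have Vp : oset V p by [].
have ha q : oset V q -> ~ pset q a by move=> [].
have hV : V `<=` U by move=> q [].
exists (@germ spec_rs p V Vp (spec_frac d ha)).
rewrite -(@germ_res spec_rs p _ _ Up Vp hV) -germM -(germ1 (X := spec_rs) Vp).
congr (germ _ _); apply: spec_ext => q Vq.
rewrite spec_valM spec_resE !mk_spec_sectionE fracM spec_val1 -frac1.
by apply: fracE; ring.
Qed.

Lemma spec_stalk_local (p : spec_rs) : local_ring (stalk spec_rs p).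
Proof.
split.
  rewrite -(@germ1 spec_rs p (oT X) Logic.I) -(@germ0 spec_rs p (oT X) Logic.I).
  move=> /germP[W [h [h' [Wp E]]]].
  have := congr1 (fun t => @spec_val A W t p Wp) E.
  cbv beta; rewrite !spec_resE spec_val1 spec_val0 -frac1 -frac0.
  move=> /fracP[t nt]; rewrite !mulr1 mulr0 => t0.
  by apply: nt; rewrite t0; apply: prime0.
move=> x y.
have [U [Up [a [d [hd ->]]]]] := spec_stalk_frac x.
have [V [Vp [b [e [he ->]]]]] := spec_stalk_frac y.
move=> /spec_stalk_unit/contrapT pa /spec_stalk_unit/contrapT pb.
have UVp : oset (oI U V) p by [].
have hU : oI U V `<=` U by move=> q [].
have hV : oI U V `<=` V by move=> q [].
rewrite -(@germ_res spec_rs p _ _ Up UVp hU) -(@germ_res spec_rs p _ _ Vp UVp hV).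
have hde q : oset (oI U V) q -> ~ pset q (d * e).
  by move=> [Uq Vq]; apply: nprimeM; [exact: hd|exact: he].
rewrite -germD (_ : _ + _ = spec_frac (a * e + b * d) hde); last first.
  apply: spec_ext => q Vq; rewrite spec_valD !spec_resE !mk_spec_sectionE fracD.
  by apply: fracE; ring.
move=> /spec_stalk_unit; apply; apply: primeD.
  by rewrite mulrC; apply: primeMr.
by rewrite mulrC; apply: primeMr.
Qed.

Definition Spec : lrSpace := LRSpace spec_stalk_local.
End SpecRingedSpace.

Lemma bijP (S T : Type) (f : S -> T) :
  injective f -> (forall y, exists x, f x = y) -> bijective f.
Proof.
move=> fi fs; have g y : {x | f x = y} by apply: cid; apply: fs.
exists (fun y => sval (g y)) => [x|y]; last exact: (svalP (g y)).
by apply: fi; apply: (svalP (g (f x))).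
Qed.

Lemma sheaf_empty (X : ringedSpace) (U : opens X) (s t : sheaf X U) :
  (U : set X) `<=` set0 -> s = t.
Proof.
move=> U0.
have [||u [_ uU]] := @sheafP X U False (False_rect _) (fun i => False_rect _ i)
  _ (fun i => False_rect _ i).
- by move=> x /U0.
- by case.
by rewrite -(uU s) ?(uU t)//; case.
Qed.

Lemma open_immersion_stalk (X Y : ringedSpace) (f : rsMor X Y) (x : X) :
  open_immersion f -> bijective (stalk_map f x).
Proof.
move=> [_ fo fb]; apply: bijP => [a b|y].
  elim/stalk_ind2: a / b => V Vfx s t.
  rewrite !(stalk_map_germ Vfx (Vfx : oset (opre (@rs_cont _ _ f) V) x)
    (@opre_sub _ _ _ (@rs_cont _ _ f) V)).
  move=> /germP[W [h [h' [Wx]]]].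
  pose fW := Opens (fo W).
  have fWx : oset fW (f x) by exists x.
  have WV : fW `<=` V by move=> _ [y Wy <-]; exact: (h y Wy).
  have WfW : W `<=` f @^-1` fW by move=> y Wy; exists y.
  rewrite (pull_res _ WfW WV) (pull_res _ WfW WV).
  move=> /(bij_inj (fb fW W WfW erefl)) st.
  by rewrite -(germ_res Vfx fWx WV s) st germ_res.
elim/stalk_ind: y => U Ux u.
pose fU := Opens (fo U).
have fUx : oset fU (f x) by exists x.
have UfU : U `<=` f @^-1` fU by move=> y Uy; exists y.
have [g _ gK] := fb fU U UfU erefl.
by exists (germ fUx (g u)); rewrite (stalk_map_germ fUx Ux UfU) gK.
Qed.

Lemma local_ring_bij (R S : comPzRingType) (f : {rmorphism R -> S}) :
  bijective f -> local_ring S -> local_ring R.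
Proof.
move=> fb [S1 Sl].
have fu a : is_unit (f a) -> is_unit a.
  move=> [b ab]; have [g _ gK] := fb; exists (g b).
  by apply: (bij_inj fb); rewrite rmorphM gK rmorph1.
split=> [e|a b na nb /(is_unit_rmorph f)].
  by apply: S1; rewrite -(rmorph1 f) e rmorph0.
by rewrite rmorphD; apply: Sl => /fu.
Qed.

Lemma open_immersion_id (X : ringedSpace) : open_immersion (rs_idmap X).
Proof.
split=> // [U|V U h VU].
  by rewrite (_ : _ @` _ = U); [exact: openP|rewrite image_id].
have UV : V `<=` U by rewrite VU => _ [y Uy <-].
by exists (res X UV) => s; rewrite /= resE res_id.
Qed.

Lemma open_immersion_comp (X Y Z : ringedSpace) (g : rsMor Y Z)
    (f : rsMor X Y) :
  open_immersion g -> open_immersion f -> open_immersion (rs_comp g f).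
Proof.
move=> [gi go gb] [fi fo fb]; split=> [x y /gi/fi//|U|V U h VU].
  have -> : rs_comp g f @` U = g @` Opens (fo U) by rewrite image_comp.
  exact: go.
pose W := Opens (fo U).
have UW : U `<=` f @^-1` W by move=> y Uy; exists y.
have VW : (V : set Z) = g @` W by rewrite VU /= image_comp.
have WV : W `<=` g @^-1` V by move=> y Wy; rewrite /preimage /= VW; exists y.
have Wpre : W `<=` opre (@rs_cont _ _ g) V by [].
apply: (@eq_bij _ _ (pull f UW \o pull g WV)).
  by apply: bij_comp; [exact: fb|exact: gb].
move=> s /=; rewrite -[RHS](res_id (@subset_refl _ _)).
rewrite (@pull_res _ _ f _ W _ _ (h : U `<=` f @^-1` _) UW Wpre).
by rewrite (@pull_res _ _ g _ V _ _ (@opre_sub _ _ _ (@rs_cont _ _ g) V) WV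
  (@subset_refl _ _)) res_id.
Qed.

Record scheme := Scheme {
  sch_lr :> lrSpace;
  sch_affine : forall x : sch_lr, exists (A : comPzRingType)
    (j : lrMor (Spec A) sch_lr), open_immersion j /\ exists y, j y = x }.

Lemma Spec_affine (A : comPzRingType) (x : Spec A) :
  exists (B : comPzRingType) (j : lrMor (Spec B) (Spec A)),
    open_immersion j /\ exists y, j y = x.
Proof.
by exists A, (lr_id _); split; [exact: open_immersion_id|exists x].
Qed.

Definition SpecS (A : comPzRingType) : scheme := Scheme (@Spec_affine A).

Section Coproduct.
Variables (I : choiceType) (X : I -> scheme).

Definition coprod_top : topologicalType := {i : I & space (X i)}.

Definition coprod_in (i : I) (x : X i) : coprod_top := existT _ i x.

Lemma coprod_in_continuous i : continuous (@coprod_in i).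
Proof. exact: existT_continuous. Qed.

Lemma coprod_in_inj i : injective (@coprod_in i).
Proof.
move=> x y /(congr1 (tagged_as (existT (fun i => X i : Type) i x))).
by rewrite !tagged_asE.
Qed.

Definition component (i : I) (U : opens coprod_top) : opens (X i) :=
  opre (@coprod_in_continuous i) U.

Definition coprod_sheaf (U : opens coprod_top) : comPzRingType :=
  @prod_ring I (fun i => sheaf (X i) (component i U)).

Lemma component_sub i (U V : opens coprod_top) :
  V `<=` U -> component i V `<=` component i U.
Proof. by move=> VU x /VU. Qed.

Section Restriction.
Variables (U V : opens coprod_top) (h : V `<=` U).

Definition coprod_res_fun (s : coprod_sheaf U) : coprod_sheaf V :=
  fun i => res (X i) (component_sub h) (s i).

Lemma coprod_res_funB s t :
  coprod_res_fun (s - t) = coprod_res_fun s - coprod_res_fun t.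
Proof.
by apply: functional_extensionality_dep => i; rewrite /coprod_res_fun rmorphB.
Qed.

Lemma coprod_res_funM s t :
  coprod_res_fun (s * t) = coprod_res_fun s * coprod_res_fun t.
Proof.
by apply: functional_extensionality_dep => i; rewrite /coprod_res_fun rmorphM.
Qed.

Lemma coprod_res_fun1 : coprod_res_fun 1 = 1.
Proof.
by apply: functional_extensionality_dep => i; rewrite /coprod_res_fun rmorph1.
Qed.

Definition coprod_res : {rmorphism coprod_sheaf U -> coprod_sheaf V} :=
  mk_rmorphism coprod_res_funB coprod_res_fun1 coprod_res_funM.
End Restriction.

Lemma coprod_resE (U V : opens coprod_top) (h : V `<=` U) s i :
  coprod_res h s i = res (X i) (component_sub h) (s i).
Proof. by []. Qed.

Lemma coprod_res_id (U : opens coprod_top) (h : U `<=` U) s :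
  coprod_res h s = s.
Proof.
by apply: functional_extensionality_dep => i; rewrite coprod_resE res_id.
Qed.

Lemma coprod_res_comp (U V W : opens coprod_top)
    (hV : V `<=` U) (hW : W `<=` V) (hWU : W `<=` U) s :
  coprod_res hW (coprod_res hV s) = coprod_res hWU s.
Proof.
apply: functional_extensionality_dep => i.
by rewrite !coprod_resE resE; apply: res_irr.
Qed.

Lemma coprod_sheafP (U : opens coprod_top) (J : Type)
    (V : J -> opens coprod_top) (hV : forall j, V j `<=` U) :
  U `<=` \bigcup_j V j ->
  forall s : forall j, coprod_sheaf (V j),
  (forall j k (W : opens coprod_top) (hj : W `<=` V j) (hk : W `<=` V k),
     coprod_res hj (s j) = coprod_res hk (s k)) ->
  exists! t : coprod_sheaf U, forall j, coprod_res (hV j) t = s j.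
Proof.
move=> UV s ss.
have glue i : exists! t : sheaf (X i) (component i U),
    forall j, res (X i) (component_sub (hV j)) t = s j i.
  apply: sheafP => [x Ux|j k W hj hk].
    by have [j _ Vx] := UV _ Ux; exists j.
  have oW : open (@coprod_in i @` W) by apply: existT_open_map; apply: openP.
  have hj' : Opens oW `<=` V j by move=> _ [y Wy <-]; exact: (hj y Wy).
  have hk' : Opens oW `<=` V k by move=> _ [y Wy <-]; exact: (hk y Wy).
  have hW : W `<=` component i (Opens oW) by move=> y Wy; exists y.
  have : res (X i) hW (coprod_res hj' (s j) i) =
    res (X i) hW (coprod_res hk' (s k) i) by rewrite (ss j k _ hj' hk').
  rewrite !coprod_resE !resE => e.
  by rewrite (res_irr _ (subset_trans hW (component_sub hj'))) e; apply: res_irr.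
pose t i := sval (cid (glue i)).
exists t; split=> [j|u hu]; apply: functional_extensionality_dep => i.
  by have [+ _] := svalP (cid (glue i)); apply.
have [_ +] := svalP (cid (glue i)); apply => j.
by rewrite -(hu j).
Qed.

Definition coprod_rs : ringedSpace :=
  RingedSpace coprod_res_id coprod_res_comp coprod_sheafP.

Section Inclusion.
Variable i : I.

Section Pull.
Variables (V : opens coprod_rs) (U : opens (X i)).
Hypothesis h : U `<=` @coprod_in i @^-1` V.

Definition incl_pull_fun (s : sheaf coprod_rs V) : sheaf (X i) U :=
  res (X i) (h : U `<=` component i V) (s i).

Lemma incl_pull_funB s t :
  incl_pull_fun (s - t) = incl_pull_fun s - incl_pull_fun t.
Proof. exact: rmorphB. Qed.

Lemma incl_pull_funM s t :
  incl_pull_fun (s * t) = incl_pull_fun s * incl_pull_fun t.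
Proof. exact: rmorphM. Qed.

Lemma incl_pull_fun1 : incl_pull_fun 1 = 1.
Proof. exact: rmorph1. Qed.

Definition incl_pull : {rmorphism sheaf coprod_rs V -> sheaf (X i) U} :=
  mk_rmorphism incl_pull_funB incl_pull_fun1 incl_pull_funM.
End Pull.

Lemma incl_pull_res (V V' : opens coprod_rs) (U U' : opens (X i))
    (h : U `<=` @coprod_in i @^-1` V) (h' : U' `<=` @coprod_in i @^-1` V')
    (hV : V' `<=` V) (hU : U' `<=` U) s :
  res (X i) hU (incl_pull h s) = incl_pull h' (res coprod_rs hV s).
Proof.
rewrite /= /rmor_fun /incl_pull_fun /coprod_res_fun !resE.
exact: res_irr.
Qed.

Definition incl_rs : rsMor (X i) coprod_rs :=
  @RSMor (X i) coprod_rs (@coprod_in i) (@coprod_in_continuous i)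
    incl_pull incl_pull_res.

Lemma incl_open_immersion : open_immersion incl_rs.
Proof.
split=> [|U|V U h VU]; first exact: coprod_in_inj.
  by apply: existT_open_map; apply: openP.
have VUi : component i V `<=` U.
  by move=> x; rewrite /= /preimage /= VU => -[y Uy /coprod_in_inj <-].
apply: bijP => [s t st|u].
  apply: functional_extensionality_dep => j.
  have [e|ne] := pselect (i = j); last first.
    apply: sheaf_empty => x; rewrite /= /preimage /= VU => -[y Uy].
    by move=> /(congr1 (@projT1 _ _)) /= /ne.
  case: j / e.
  have := congr1 (res (X i) VUi) st.
  by rewrite /= /rmor_fun /incl_pull_fun !resE !res_id.
pose s : sheaf coprod_rs V := fun j =>
  match pselect (i = j) with
  | left e => eq_rect i (fun k => sheaf (X k) (component k V))
      (res (X i) VUi u) j e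
  | right _ => 0
  end.
exists s; rewrite /= /rmor_fun /incl_pull_fun /s; case: pselect => // e.
by rewrite (Prop_irrelevance e erefl) /= resE res_id.
Qed.
End Inclusion.

Lemma coprod_local (x : coprod_rs) : local_ring (stalk coprod_rs x).
Proof.
case: x => i x; apply: (local_ring_bij (f := stalk_map (incl_rs i) x)).
  by apply: open_immersion_stalk; apply: incl_open_immersion.
exact: lr_local.
Qed.

Definition coprod_lr : lrSpace := LRSpace coprod_local.

Lemma incl_local i x : local_hom (stalk_map (incl_rs i : rsMor _ coprod_lr) x).
Proof.
move=> a [b ab].
have fb := open_immersion_stalk x (incl_open_immersion i).
have [g _ gK] := fb; exists (g b).
by apply: (bij_inj fb); rewrite rmorphM gK rmorph1.
Qed.

Definition incl (i : I) : lrMor (X i) coprod_lr := LRMor (@incl_local i).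

Lemma coprod_affine (x : coprod_lr) : exists (A : comPzRingType)
    (j : lrMor (Spec A) coprod_lr), open_immersion j /\ exists y, j y = x.
Proof.
case: x => i x; have [A [j [jo [y jy]]]] := sch_affine x.
exists A, (lr_comp (incl i) j); split.
  by apply: open_immersion_comp => //; apply: incl_open_immersion.
by exists y; rewrite /= jy.
Qed.

Definition coprod : scheme := Scheme coprod_affine.

Section Copairing.
Variables (Y : lrSpace) (f : forall i, lrMor (X i) Y).

Definition copair_map (x : coprod_rs) : Y := f (projT1 x) (projT2 x).

Lemma copair_continuous : continuous copair_map.
Proof.
apply/continuousP => V oV; apply/sigT_openP => i.
exact: (open_preimage (@rs_cont _ _ (f i)) oV).
Qed.

Section Pull.
Variables (V : opens Y) (U : opens coprod_rs).
Hypothesis h : U `<=` copair_map @^-1` V.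

Lemma copair_sub i : component i U `<=` f i @^-1` V.
Proof. by move=> x /h. Qed.

Definition copair_pull_fun (s : sheaf Y V) : sheaf coprod_rs U :=
  fun i => pull (f i) (@copair_sub i) s.

Lemma copair_pull_funB s t :
  copair_pull_fun (s - t) = copair_pull_fun s - copair_pull_fun t.
Proof.
by apply: functional_extensionality_dep => i; rewrite /copair_pull_fun rmorphB.
Qed.

Lemma copair_pull_funM s t :
  copair_pull_fun (s * t) = copair_pull_fun s * copair_pull_fun t.
Proof.
by apply: functional_extensionality_dep => i; rewrite /copair_pull_fun rmorphM.
Qed.

Lemma copair_pull_fun1 : copair_pull_fun 1 = 1.
Proof.
by apply: functional_extensionality_dep => i; rewrite /copair_pull_fun rmorph1.
Qed.

Definition copair_pull : {rmorphism sheaf Y V -> sheaf coprod_rs U} :=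
  mk_rmorphism copair_pull_funB copair_pull_fun1 copair_pull_funM.
End Pull.

Lemma copair_pull_res (V V' : opens Y) (U U' : opens coprod_rs)
    (h : U `<=` copair_map @^-1` V) (h' : U' `<=` copair_map @^-1` V')
    (hV : V' `<=` V) (hU : U' `<=` U) s :
  res coprod_rs hU (copair_pull h s) = copair_pull h' (res Y hV s).
Proof.
apply: functional_extensionality_dep => i; rewrite /= /rmor_fun /coprod_res_fun /copair_pull_fun.
exact: pull_res.
Qed.

Definition copair_rs : rsMor coprod_rs Y :=
  @RSMor coprod_rs Y copair_map copair_continuous copair_pull copair_pull_res.

Lemma copair_local (x : coprod_lr) : local_hom (stalk_map copair_rs x).
Proof.
case: x => i x a /(is_unit_rmorph (stalk_map (incl_rs i) x)) h.
apply: (@lr_mor_local _ _ (f i) x); move: h.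
elim/stalk_ind: a => V Vfx s.
pose U := opre copair_continuous V.
have Ux : oset U (coprod_in x) by [].
rewrite (@stalk_map_germ _ _ copair_rs (coprod_in x) V U Vfx Ux
  (@opre_sub _ _ _ _ _)).
rewrite (@stalk_map_germ _ _ (incl_rs i) x U (component i U) Ux Ux
  (@opre_sub _ _ _ _ _)).
rewrite (@stalk_map_germ _ _ (f i) x V (component i U) Vfx Ux
  (@copair_sub V U (@opre_sub _ _ _ _ _) i)).
by rewrite /= /rmor_fun /incl_pull_fun res_id.
Qed.

Definition copair : lrMor coprod Y :=
  @LRMor coprod Y copair_rs copair_local.
End Copairing.
End Coproduct.

(* There is at most one morphism from a scheme to Spec F_p. *)
Definition Fp_scheme (p : nat) (X : lrSpace) : Prop :=
  inhabited (lrMor X (Spec 'F_p)).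

Lemma natr_Spec_Fp (p : nat) (U : opens (spec_top 'F_p)) :
  prime p -> p%:R = 0 :> spec_sheaf U.
Proof.
move=> pp; have valn n q (Uq : oset U q) :
    spec_val (n%:R : spec_sheaf U) Uq = frac n%:R (@prime1 _ q).
  elim: n => [|n IH]; first by rewrite spec_val0.
  rewrite !mulrS spec_valD IH spec_val1 -frac1 fracD.
  by apply: fracE; ring.
apply: spec_ext => q Uq.
by rewrite valn (pcharf0 (pchar_Fp pp)) spec_val0.
Qed.

Lemma natr_Fp_scheme (p : nat) (X : lrSpace) (U : opens X) :
  prime p -> Fp_scheme p X -> p%:R = 0 :> sheaf X U.
Proof.
move=> pp [f]; have h : U `<=` f @^-1` oT _ by [].
by rewrite -(rmorph_nat (pull f h)) (natr_Spec_Fp _ pp) rmorph0.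
Qed.

(* MathComp's Frobenius morphism excludes the zero ring. *)
Lemma frobD (R : comPzRingType) (p : nat) :
  prime p -> p%:R = 0 :> R ->
  forall x y : R, (x + y) ^+ p = x ^+ p + y ^+ p.
Proof.
move=> pp p0 x y; rewrite exprDn big_ord_recr /= subnn expr0 mul1r binn mulr1n.
case: p pp p0 => // p pp p0; rewrite big_ord_recl /= subn0 expr0 mulr1 mulr1n.
rewrite big1 ?addr0 // => i _; rewrite /bump /= add1n.
have /dvdnP[m ->] : (p.+1 %| 'C(p.+1, i.+1))%N.
  by apply: prime_dvd_bin; rewrite //= ltnS.
by rewrite -mulr_natr natrM p0 !mulr0.
Qed.

Lemma frobB (R : comPzRingType) (p : nat) :
  prime p -> p%:R = 0 :> R ->
  forall x y : R, (x - y) ^+ p = x ^+ p - y ^+ p.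
Proof.
move=> pp p0 x y; apply/eqP; rewrite -subr_eq opprK.
by rewrite -frobD // subrK.
Qed.

Section Frobenius.
Variables (p : nat) (p_prime : prime p) (X : lrSpace) (hX : Fp_scheme p X).

Section Pull.
Variables (V U : opens X) (h : U `<=` (fun x : X => x) @^-1` V).

Definition frob_fun (s : sheaf X V) : sheaf X U :=
  res X (h : U `<=` V) s ^+ p.

Lemma frob_funB s t : frob_fun (s - t) = frob_fun s - frob_fun t.
Proof.
by rewrite /frob_fun rmorphB frobB //; apply: natr_Fp_scheme.
Qed.

Lemma frob_funM s t : frob_fun (s * t) = frob_fun s * frob_fun t.
Proof. by rewrite /frob_fun rmorphM exprMn. Qed.

Lemma frob_fun1 : frob_fun 1 = 1.
Proof. by rewrite /frob_fun rmorph1 expr1n. Qed.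

Definition frob_pull : {rmorphism sheaf X V -> sheaf X U} :=
  mk_rmorphism frob_funB frob_fun1 frob_funM.
End Pull.

Lemma frob_pull_res (V V' U U' : opens X) (h : U `<=` (fun x : X => x) @^-1` V)
    (h' : U' `<=` (fun x : X => x) @^-1` V') (hV : V' `<=` V) (hU : U' `<=` U)
    s : res X hU (frob_pull h s) = frob_pull h' (res X hV s).
Proof.
rewrite /= /rmor_fun /frob_fun rmorphXn !resE; congr (_ ^+ p).
exact: res_irr.
Qed.

Definition frob_rs : rsMor X X :=
  @RSMor X X (fun x => x) (@id_continuous X) frob_pull frob_pull_res.

Lemma frob_local (x : X) : local_hom (stalk_map frob_rs x).
Proof.
move=> a; have -> : stalk_map frob_rs x a = a ^+ p.
  elim/stalk_ind: a => U Ux s.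
  rewrite (@stalk_map_germ _ _ frob_rs x U U Ux Ux (@subset_refl _ _)).
  rewrite /= /rmor_fun /frob_fun res_id.
  elim: p => [|n IH]; first by rewrite !expr0 germ1.
  by rewrite !exprS germM IH.
move=> [b ab]; case: p p_prime ab => // n _; rewrite exprS -mulrA => ab.
by exists (a ^+ n * b).
Qed.

(* The absolute Frobenius endomorphism: the identity on the space, and the
   p-th power map on sections. *)
Definition frobenius : lrMor X X := LRMor frob_local.
End Frobenius.

Definition perfect_scheme (p : nat) (p_prime : prime p) (X : scheme) : Prop :=
  exists hX : Fp_scheme p X, lr_iso (frobenius p_prime hX).

Record inverse_perfection (p : nat) (p_prime : prime p) (Y : scheme) :=
  InversePerfection {
    ip_sch : scheme;
    ip_phi : lrMor ip_sch Y;
    ip_perfect : perfect_scheme p_prime ip_sch;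
    ip_univ : forall T : scheme, perfect_scheme p_prime T ->
      forall f : lrMor T Y, exists! g : lrMor T ip_sch, lr_comp ip_phi g = f }.

(* Tensor products and flatness. For a ring morphism f : A -> B and an
   A-module M, the elements of the tensor product of M and B over A are
   represented by lists of pairs (m, b), standing for the sum of the m (x) b;
   tens_eq is equality in the tensor product. *)
Section Tensor.
Variables (A B : comPzRingType) (f : {rmorphism A -> B}) (M : lmodType A).

Inductive tens_eq : seq (M * B) -> seq (M * B) -> Prop :=
| TensRefl s : tens_eq s s
| TensSym s t : tens_eq s t -> tens_eq t s
| TensTrans s t u : tens_eq s t -> tens_eq t u -> tens_eq s u
| TensCat s s' t t' :
    tens_eq s s' -> tens_eq t t' -> tens_eq (s ++ t) (s' ++ t')
| TensComm s t : tens_eq (s ++ t) (t ++ s)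
| Tens0 b : tens_eq [:: (0, b)] [::]
| TensDl m m' b : tens_eq [:: (m + m', b)] [:: (m, b); (m', b)]
| TensDr m b b' : tens_eq [:: (m, b + b')] [:: (m, b); (m, b')]
| TensZ a m b : tens_eq [:: (a *: m, b)] [:: (m, f a * b)].
End Tensor.

Definition flat_hom (A B : comPzRingType) (f : {rmorphism A -> B}) : Prop :=
  forall (M N : lmodType A) (u : {linear M -> N}), injective u ->
  forall s t : seq (M * B),
    tens_eq f [seq (u x.1, x.2) | x <- s] [seq (u x.1, x.2) | x <- t] ->
    tens_eq f s t.

Definition flat (X Y : scheme) (f : lrMor X Y) : Prop :=
  forall x : X, flat_hom (stalk_map f x).

Definition faithfully_flat (X Y : scheme) (f : lrMor X Y) : Prop :=
  flat f /\ forall y : Y, exists x : X, f x = y.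

(* For U open in X with f(U) open in Y: the induced morphism U -> f(U) is
   quasi-compact. The library's compact does not include separation. *)
Definition quasi_compact_on (X Y : scheme) (f : lrMor X Y) (U : opens X) :
    Prop :=
  forall W : opens Y, W `<=` f @` U -> compact (W : set Y) ->
    compact (U `&` f @^-1` W).

Definition fpqc_morphism (X Y : scheme) (f : lrMor X Y) : Prop :=
  faithfully_flat f /\
  forall x : X, exists U : opens X,
    [/\ oset U x, open (f @` U) & quasi_compact_on f U].

(* copair f is the induced morphism from the disjoint union of the X i. *)
Definition fpqc_covering (Y : scheme) (I : choiceType) (X : I -> scheme)
    (f : forall i, lrMor (X i) Y) : Prop :=
  (forall i, flat (f i)) /\ fpqc_morphism (copair f).

Section OverField.
Variable k : fieldType.

Record kScheme := KScheme {
  ks_sch :> scheme;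
  ks_str : lrMor ks_sch (Spec k) }.

Record kMor (X Y : kScheme) := KMor {
  km_mor :> lrMor X Y;
  km_str : lr_comp (ks_str Y) km_mor = ks_str X }.

Lemma kMor_ext (X Y : kScheme) (f g : kMor X Y) :
  (f : lrMor X Y) = g -> f = g.
Proof.
case: f g => f hf [g hg] /= e; subst g.
by rewrite (Prop_irrelevance hf hg).
Qed.

Lemma km_comp_str (X Y Z : kScheme) (g : kMor Y Z) (f : kMor X Y) :
  lr_comp (ks_str Z) (lr_comp g f) = ks_str X.
Proof. by rewrite lr_compA !km_str. Qed.

Definition km_comp (X Y Z : kScheme) (g : kMor Y Z) (f : kMor X Y) :
  kMor X Z := KMor (km_comp_str g f).

Lemma km_compA (X Y Z T : kScheme) (h : kMor Z T) (g : kMor Y Z)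
    (f : kMor X Y) : km_comp h (km_comp g f) = km_comp (km_comp h g) f.
Proof. by apply: kMor_ext; apply: lr_compA. Qed.

(* The full subcategory of Sch/k defined by a property C of k-schemes. *)
Section FullSubcategory.
Variable C : kScheme -> Prop.

Record object := Object {
  ob_sch :> kScheme;
  ob_in : C ob_sch }.

(* A group in the category: an object G together with a group structure on
   Hom_k(T, G), functorial in the object T. *)
Record groupObject := GroupObject {
  go_ob :> object;
  go_mul : forall T : object, kMor T go_ob -> kMor T go_ob -> kMor T go_ob;
  go_one : forall T : object, kMor T go_ob;
  go_inv : forall T : object, kMor T go_ob -> kMor T go_ob;
  go_mulA : forall (T : object) (a b c : kMor T go_ob),
    go_mul a (go_mul b c) = go_mul (go_mul a b) c;
  go_mul1 : forall (T : object) (a : kMor T go_ob), go_mul (go_one T) a = a;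
  go_mulV : forall (T : object) (a : kMor T go_ob), go_mul (go_inv a) a = go_one T;
  go_mul_comp : forall (S T : object) (u : kMor S T) (a b : kMor T go_ob),
    km_comp (go_mul a b) u = @go_mul S (km_comp a u) (km_comp b u) }.

Record groupMor (G H : groupObject) := GroupMor {
  gm_mor :> kMor G H;
  gm_mul : forall (T : object) (a b : kMor T G),
    km_comp gm_mor (go_mul a b) =
    @go_mul H T (km_comp gm_mor a) (km_comp gm_mor b) }.

Definition fpqc_exact (F G H : groupObject)
    (i : groupMor F G) (q : groupMor G H) : Prop :=
  [/\ forall (T : object) (a b : kMor T F),
        km_comp i a = km_comp i b -> a = b,
      forall (T : object) (g : kMor T G),
        km_comp q g = go_one H T <-> exists a : kMor T F, km_comp i a = g
    & forall (U : object) (s : kMor U H),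
        exists (J : choiceType) (X : J -> object) (f : forall j, kMor (X j) U),
          fpqc_covering (fun j => f j : lrMor (X j) U) /\
          forall j, exists g : kMor (X j) G, km_comp q g = km_comp s (f j)].
End FullSubcategory.

Definition Sch (X : kScheme) : Prop := True.

Section Perfection.
Variables (p : nat) (p_prime : prime p).

Definition Perf (X : kScheme) : Prop := perfect_scheme p_prime X.

Definition sch_of_perf (T : object Perf) : object Sch :=
  @Object Sch T Logic.I.

Section PerfectionScheme.
Variables (Y : kScheme) (P : inverse_perfection p_prime Y).

(* The k-scheme structure of Y^pf is the one induced by phi. *)
Definition pf_kScheme : kScheme := KScheme (lr_comp (ks_str Y) (ip_phi P)).

Definition pf : object Perf := @Object Perf pf_kScheme (ip_perfect P).

Definition pf_phi : kMor pf Y := @KMor pf Y (ip_phi P) erefl.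

Lemma pf_univ (T : object Perf) (f : kMor T Y) :
  exists! g : kMor T pf, km_comp pf_phi g = f.
Proof.
have [g [gf gu]] := ip_univ P (ob_in T) f.
have gs : lr_comp (ks_str pf) g = ks_str T.
  by rewrite /= -lr_compA gf km_str.
exists (@KMor T pf g gs); split; first exact: kMor_ext.
move=> h hf; apply: kMor_ext; apply: gu.
by rewrite -hf.
Qed.

Definition pf_lift (T : object Perf) (f : kMor T Y) : kMor T pf :=
  sval (cid (pf_univ f)).

Lemma pf_liftK (T : object Perf) (f : kMor T Y) :
  km_comp pf_phi (pf_lift f) = f.
Proof. by have [] := svalP (cid (pf_univ f)). Qed.

Lemma pf_phi_inj (T : object Perf) (a b : kMor T pf) :
  km_comp pf_phi a = km_comp pf_phi b -> a = b.
Proof.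
move=> ab; have [g [_ gu]] := pf_univ (km_comp pf_phi a).
by rewrite -(gu a erefl) (gu b).
Qed.
End PerfectionScheme.

Section PerfectionGroup.
Variables (G : groupObject Sch) (P : inverse_perfection p_prime G).
Local Notation phi := (pf_phi P).

(* The group structure for which Hom(T, G^pf) -> Hom(T, G) is an isomorphism of
   groups for all perfect T. *)
Definition pf_mul (T : object Perf) (a b : kMor T (pf P)) : kMor T (pf P) :=
  pf_lift P (@go_mul _ G (sch_of_perf T) (km_comp phi a) (km_comp phi b)).

Definition pf_one (T : object Perf) : kMor T (pf P) :=
  pf_lift P (go_one G (sch_of_perf T)).

Definition pf_inv (T : object Perf) (a : kMor T (pf P)) : kMor T (pf P) :=
  pf_lift P (@go_inv _ G (sch_of_perf T) (km_comp phi a)).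

Lemma pf_mulA (T : object Perf) (a b c : kMor T (pf P)) :
  pf_mul a (pf_mul b c) = pf_mul (pf_mul a b) c.
Proof. by apply: pf_phi_inj; rewrite /pf_mul /pf_one /pf_inv !pf_liftK go_mulA. Qed.

Lemma pf_mul1 (T : object Perf) (a : kMor T (pf P)) : pf_mul (pf_one T) a = a.
Proof. by apply: pf_phi_inj; rewrite /pf_mul /pf_one /pf_inv !pf_liftK go_mul1. Qed.

Lemma pf_mulV (T : object Perf) (a : kMor T (pf P)) :
  pf_mul (pf_inv a) a = pf_one T.
Proof. by apply: pf_phi_inj; rewrite /pf_mul /pf_one /pf_inv !pf_liftK go_mulV. Qed.

Lemma pf_mul_comp (S T : object Perf) (u : kMor S T) (a b : kMor T (pf P)) :
  km_comp (pf_mul a b) u = @pf_mul S (km_comp a u) (km_comp b u).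
Proof.
apply: pf_phi_inj; rewrite /pf_mul pf_liftK !km_compA pf_liftK.
exact: (@go_mul_comp _ G (sch_of_perf S) (sch_of_perf T)).
Qed.

Definition pf_group : groupObject Perf :=
  GroupObject pf_mulA pf_mul1 pf_mulV pf_mul_comp.

Lemma pf_phi_mul (T : object Perf) (a b : kMor T pf_group) :
  km_comp phi (@go_mul _ pf_group T a b) =
  @go_mul _ G (sch_of_perf T) (km_comp phi a) (km_comp phi b).
Proof. exact: pf_liftK. Qed.
End PerfectionGroup.

Section PerfectionMorphism.
Variables (G H : groupObject Sch) (PG : inverse_perfection p_prime G)
  (PH : inverse_perfection p_prime H) (u : groupMor G H).

Definition pf_mor_fun : kMor (pf PG) (pf PH) :=
  pf_lift PH (km_comp u (pf_phi PG)).

Lemma pf_mor_funE :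
  km_comp (pf_phi PH) pf_mor_fun = km_comp u (pf_phi PG).
Proof. exact: pf_liftK. Qed.

Lemma pf_mor_mul (T : object Perf) (a b : kMor T (pf_group PG)) :
  km_comp pf_mor_fun (go_mul a b) =
  @go_mul _ (pf_group PH) T (km_comp pf_mor_fun a) (km_comp pf_mor_fun b).
Proof.
apply: pf_phi_inj; rewrite pf_phi_mul !km_compA pf_mor_funE.
rewrite -!km_compA pf_phi_mul.
exact: (@gm_mul _ _ _ u (sch_of_perf T)).
Qed.

(* The unique morphism such that phi_H \o u^pf = u \o phi_G. *)
Definition pf_mor : groupMor (pf_group PG) (pf_group PH) :=
  @GroupMor _ (pf_group PG) (pf_group PH) pf_mor_fun pf_mor_mul.
End PerfectionMorphism.
End Perfection.
End OverField.

(* Main.v *)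
From HB Require Import structures.
Require Import Defs.
From mathcomp Require Import all_boot all_algebra.
From mathcomp Require Import all_classical topology ring.

Set Implicit Arguments.
Unset Strict Implicit.
Unset Printing Implicit Defensive.

Import GRing.Theory.
Local Open Scope classical_set_scope.
Local Open Scope ring_scope.

(** Injectivity of F^pf -> G^pf and the description of its image are formal:
    on a perfect scheme T, composition with phi identifies Hom(T, Y^pf) with
    Hom(T, Y), so these two conditions for T are those of the original sequence
    for T.

    The content is local surjectivity. Let U be perfect and let s be a point of
    H^pf over U. Its image in H lifts to G over an fpqc covering of U by schemes
    X_j which need not be perfect. It suffices to refine this covering into an
    fpqc covering of U by perfect schemes: the lifts to G pulled back to perfect
    schemes factor through G^pf, and they lift s because H^pf -> H is injective
    on points over perfect schemes.

    Let S be the disjoint union of the X_j. Choose an affine chart Spec A of S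
    around every point of S, and replace A by the perfection D of A / p, which
    is the colimit of A / p under the Frobenius. This gives a family
    Spec D -> Spec A -> S -> U with perfect members, and
    [affine_refinement_fpqc], [flat_perfection] and [spec_map_perfection_surj]
    show that it is an fpqc covering.

    Flatness is where the perfectness of U is used. Let B be a stalk of U, C the
    stalk of S over it and E the stalk of Spec D above. The ring E is the
    colimit of copies of C under the Frobenius, and it becomes a colimit of
    B-algebras if the n-th copy of C receives B by b |-> f(b^(p^n)). As the
    Frobenius of B is bijective, each of these maps is flat when f is; and a
    filtered colimit of flat algebras is flat. In terms of elements: an equality
    of tensors over E descends to some copy of C, there flatness applies, and
    the result is pushed back to E.

    Quasi-compactness survives the passage to charts. Let x be a point of S,
    let V be an open neighbourhood of x in S with open image in U and
    quasi-compact over it, and let W be an affine open subset of that image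
    containing the image of x. Then V meets the preimage of W in a compact set,
    which is covered by finitely many basic open sets of charts. As the
    morphisms Spec D -> Spec A are surjective, the corresponding basic open sets
    of the Spec D have together the image W; and the preimage in each of them of
    a compact open subset of W is compact ([affine_preimage_compact]), because
    W is affine. *)

(** * The perfection of a ring *)

Section IteratedFrobenius.
Variables (p : nat) (p_prime : prime p).

Section Def.
Variables (R : comPzRingType) (p0 : p%:R = 0 :> R) (n : nat).

Definition frobn_fun (x : R) : R := x ^+ (p ^ n).

Lemma frobn_funB x y : frobn_fun (x - y) = frobn_fun x - frobn_fun y.
Proof.
rewrite /frobn_fun; elim: n x y => [|m IH] x y; first by rewrite expn0 !expr1.
by rewrite expnS !exprM frobB ?IH.
Qed.

Lemma frobn_fun1 : frobn_fun 1 = 1. Proof. exact: expr1n. Qed.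

Lemma frobn_funM x y : frobn_fun (x * y) = frobn_fun x * frobn_fun y.
Proof. exact: exprMn. Qed.

(* Locked, so that simplification keeps the iterates of Frobenius folded. *)
Definition frobn : {rmorphism R -> R} :=
  locked (mk_rmorphism frobn_funB frobn_fun1 frobn_funM).

Lemma frobnE x : frobn x = x ^+ (p ^ n). Proof. by rewrite /frobn -lock. Qed.
End Def.

Lemma frobn_frobn (R : comPzRingType) (p0 : p%:R = 0 :> R) m n x :
  frobn p0 m (frobn p0 n x) = frobn p0 (m + n) x.
Proof. by rewrite !frobnE -exprM addnC expnD. Qed.

Lemma frobn0 (R : comPzRingType) (p0 : p%:R = 0 :> R) x : frobn p0 0 x = x.
Proof. by rewrite frobnE expn0 expr1. Qed.

Definition perfect_ring (R : comPzRingType) : Prop :=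
  p%:R = 0 :> R /\ bijective (fun x : R => x ^+ p).

Lemma perfect_bij (R : comPzRingType) n :
  perfect_ring R -> bijective (fun x : R => x ^+ (p ^ n)).
Proof.
move=> [_ bF]; elim: n => [|n IH].
  by apply: (@eq_bij _ _ id) => [|x]; [exists id|rewrite expn0 expr1].
apply: (@eq_bij _ _ (_ \o _) (bij_comp bF IH)) => x /=.
by rewrite expnSr exprM.
Qed.

(** Abstracts A -> (A / p)^pf by properties that pass to stalks, where both rings
    are replaced by localizations. The kernel is described modulo p because p
    need not vanish in A. *)
Definition p_radicial (A D : comPzRingType) (g : A -> D) : Prop :=
  (forall d, exists n a, d ^+ (p ^ n) = g a) /\
  (forall a, g a = 0 -> exists n c, a ^+ (p ^ n) = p%:R * c).

Section ModP.
Variable A : comPzRingType.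

Definition modp_eq (x y : A) : Prop := exists c, x - y = p%:R * c.

Definition modp_setoid : ring_setoid.
Proof.
refine (@RingSetoid A modp_eq 0 1 -%R +%R *%R _ _ _ _ _ _ _ _ _ _ _ _ _ _).
- by move=> x; exists 0; ring.
- by move=> x y [c e]; exists (- c); rewrite mulrN -e opprB.
- by move=> y x z [c e] [d e']; exists (c + d); rewrite mulrDr -e -e'; ring.
- by move=> x x' [c e]; exists (- c); rewrite mulrN -e; ring.
- by move=> x x' y y' [c e] [d e']; exists (c + d); rewrite mulrDr -e -e'; ring.
- move=> x x' y y' [c e] [d e']; exists (c * y + x' * d).
  by rewrite mulrDr mulrA -e mulrCA -e'; ring.
all: by move=> *; exists 0; ring.
Defined.

Definition modp : comPzRingType := qring modp_setoid.
Definition modp_fun (x : A) : modp := qclass (x : modp_setoid).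

Lemma modp_funB x y : modp_fun (x - y) = modp_fun x - modp_fun y.
Proof. by rewrite -qclassN -qclassD. Qed.
Lemma modp_fun1 : modp_fun 1 = 1. Proof. by []. Qed.
Lemma modp_funM x y : modp_fun (x * y) = modp_fun x * modp_fun y.
Proof. by rewrite -qclassM. Qed.

Definition modp_map : {rmorphism A -> modp} :=
  mk_rmorphism modp_funB modp_fun1 modp_funM.

Lemma modp_char : p%:R = 0 :> modp.
Proof.
rewrite -(rmorph_nat modp_map); apply/(@qclassP modp_setoid).
by exists 1; rewrite mulr1; exact: subr0.
Qed.

Lemma modp_surj y : exists x, modp_map x = y.
Proof. by elim/qring_ind: y => x; exists x. Qed.

Lemma modp_ker x : modp_map x = 0 -> exists c, x = p%:R * c.
Proof. by move=> /(@qclassP modp_setoid)[c]; rewrite subr0 => ->; exists c. Qed.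
End ModP.

(** The pair (a, n) stands for the p^n-th root of a, that is, for the class of
    a in the n-th term of the colimit of R -> R -> ... along the Frobenius. *)
Section Colimit.
Variables (R : comPzRingType) (p0 : p%:R = 0 :> R).
Local Notation F := (frobn p0).

Definition colim_eq (x y : R * nat) : Prop :=
  exists l, F (y.2 + l) x.1 = F (x.2 + l) y.1.

Lemma colim_eqE x y : F y.2 x.1 = F x.2 y.1 -> colim_eq x y.
Proof. by exists 0%N; rewrite !addn0. Qed.

Local Ltac colim :=
  move=> *; apply: colim_eqE => /=;
  rewrite ?(rmorphD, rmorphM, rmorphN, rmorph0, rmorph1, frobn_frobn);
  rewrite ?(rmorphD, rmorphM, rmorphN, rmorph0, rmorph1, frobn_frobn);
  rewrite ?(addn0, add0n).

Definition colim_setoid : ring_setoid.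
Proof.
refine (@RingSetoid (R * nat) colim_eq (0, 0%N) (1, 0%N)
  (fun x => (- x.1, x.2))
  (fun x y => (F y.2 x.1 + F x.2 y.1, (x.2 + y.2)%N))
  (fun x y => (F y.2 x.1 * F x.2 y.1, (x.2 + y.2)%N))
  _ _ _ _ _ _ _ _ _ _ _ _ _ _).
- by move=> x; apply: colim_eqE.
- by move=> x y [l e]; exists l.
- move=> [b m] [a n] [c r] [l /= e] [l' /= e']; exists (m + l + l')%N => /=.
  rewrite (_ : r + _ = r + l' + (m + l))%N; last by ring.
  rewrite -(frobn_frobn p0 (r + l')) e frobn_frobn.
  rewrite (_ : _ + (n + l) = n + l + (r + l'))%N; last by ring.
  by rewrite -(frobn_frobn p0 (n + l)) e' frobn_frobn; congr (F _ _); ring.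
- by move=> x x' [l e]; exists l; rewrite /= !rmorphN e.
- move=> [a n] [a' n'] [b m] [b' m'] [l /= e] [l' /= e']; exists (l + l')%N.
  rewrite /= !rmorphD !frobn_frobn.
  have -> : (n' + m' + (l + l') + m = (m + m' + l') + (n' + l))%N by ring.
  have -> : (n' + m' + (l + l') + n = (n + n' + l) + (m' + l'))%N by ring.
  rewrite -(frobn_frobn p0 (m + m' + l')) -(frobn_frobn p0 (n + n' + l)).
  rewrite e e' !frobn_frobn.
  by congr (F _ _ + F _ _); ring.
- move=> [a n] [a' n'] [b m] [b' m'] [l /= e] [l' /= e']; exists (l + l')%N.
  rewrite /= !rmorphM !frobn_frobn.
  have -> : (n' + m' + (l + l') + m = (m + m' + l') + (n' + l))%N by ring.
  have -> : (n' + m' + (l + l') + n = (n + n' + l) + (m' + l'))%N by ring.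
  rewrite -(frobn_frobn p0 (m + m' + l')) -(frobn_frobn p0 (n + n' + l)).
  rewrite e e' !frobn_frobn.
  by congr (F _ _ * F _ _); ring.
- by colim; rewrite addrA; congr (F _ _ + F _ _ + F _ _); ring.
- by colim; rewrite addrC; congr (F _ _ + F _ _); ring.
- by colim; rewrite add0r.
- by colim; rewrite addNr.
- by colim; rewrite mulrA; congr (F _ _ * F _ _ * F _ _); ring.
- by colim; rewrite mulrC; congr (F _ _ * F _ _); ring.
- by colim; rewrite mul1r.
- colim; rewrite mulrDl.
  by congr (F _ _ * F _ _ + F _ _ * F _ _); ring.
Defined.

Definition colim : comPzRingType := qring colim_setoid.

Definition colim_in (a : R) (n : nat) : colim := qclass ((a, n) : colim_setoid).

Lemma colimP a n b m :
  colim_in a n = colim_in b m <-> exists l, F (m + l) a = F (n + l) b.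
Proof. exact: (@qclassP colim_setoid). Qed.

Lemma colim_inM a b n : colim_in (a * b) n = colim_in a n * colim_in b n.
Proof.
rewrite -qclassM; apply/colimP; exists 0%N => /=.
by rewrite -rmorphM frobn_frobn !addn0.
Qed.

Lemma colim_in1 n : colim_in 1 n = 1.
Proof. by apply/colimP; exists 0%N; rewrite !rmorph1. Qed.

Lemma colim_inX a n m : colim_in (a ^+ m) n = colim_in a n ^+ m.
Proof.
elim: m => [|m IH]; first by rewrite !expr0 colim_in1.
by rewrite !exprS colim_inM IH.
Qed.

Definition colim_fun (a : R) : colim := colim_in a 0.

Lemma colim_funB a b : colim_fun (a - b) = colim_fun a - colim_fun b.
Proof.
by rewrite -qclassN -qclassD; apply/colimP; exists 0%N; rewrite /= !frobn0.
Qed.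

Lemma colim_funM a b : colim_fun (a * b) = colim_fun a * colim_fun b.
Proof. exact: colim_inM. Qed.

Definition colim_map : {rmorphism R -> colim} :=
  mk_rmorphism colim_funB (colim_in1 0) colim_funM.

Lemma colim_pow a n m : colim_in a (n + m) ^+ (p ^ m) = colim_in a n.
Proof.
rewrite -colim_inX; apply/colimP; exists 0%N.
by rewrite -(frobnE p0) frobn_frobn !addn0.
Qed.

(** Shifting the index by one, from (a, n) to (a, n + 1), extracts the p-th
    root. *)
Lemma colim_perfect : perfect_ring colim.
Proof.
split; first by rewrite -(rmorph_nat colim_map) p0 rmorph0.
apply: bijP => [x y|y].
  elim/qring_ind: x => -[a n]; elim/qring_ind: y => -[b m].
  rewrite -!/(colim_in _ _) -!colim_inX => /colimP[l].
  have pE c : c ^+ p = F 1 c by rewrite frobnE expn1.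
  rewrite !pE !frobn_frobn => e; apply/colimP; exists (l + 1)%N.
  by rewrite !addnA.
elim/qring_ind: y => -[a n]; exists (colim_in a (n + 1)).
by rewrite -[p in _ ^+ p]expn1 colim_pow.
Qed.

Lemma colim_radicial : p_radicial colim_map.
Proof.
split=> [d|a /colimP[l]].
  elim/qring_ind: d => -[a n]; exists n, a.
  by rewrite -[n in (a, n)]add0n -/(colim_in _ _) colim_pow.
by rewrite !add0n rmorph0 frobnE => e; exists l, 0; rewrite e mulr0.
Qed.
End Colimit.

(** The reduction modulo p makes the construction available for every ring. When
    p = 0 in the structure sheaf of Spec A, it changes neither the points nor
    the stalks, since p vanishes in every localization of A. *)
Definition perfection (A : comPzRingType) : comPzRingType :=
  colim (modp_char A).

Definition to_perfection (A : comPzRingType) :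
    {rmorphism A -> perfection A} :=
  colim_map (modp_char A) \o modp_map A.

Lemma perfection_perfect A : perfect_ring (perfection A).
Proof. exact: colim_perfect. Qed.

Lemma to_perfection_radicial A : p_radicial (to_perfection A).
Proof.
have [sur ker] := colim_radicial (modp_char A); split=> [d|a /= /ker].
  have [n [b db]] := sur d; have [a ab] := modp_surj b.
  by exists n, a; rewrite /= ab.
move=> [n [c]]; rewrite modp_char mul0r => e; exists n.
by apply: modp_ker; rewrite rmorphXn.
Qed.
End IteratedFrobenius.

(** * Flatness over a perfect ring *)

Definition on_snd (M B C : Type) (h : B -> C) (s : seq (M * B)) : seq (M * C) :=
  [seq (x.1, h x.2) | x <- s].

Lemma on_sndK (M B C : Type) (h : B -> C) (g : C -> B) :
  cancel h g -> cancel (@on_snd M B C h) (on_snd g).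
Proof.
move=> hK s; rewrite /on_snd -map_comp -[RHS]map_id.
by apply: eq_map => -[m b] /=; rewrite hK.
Qed.

Lemma on_snd_mapl (M N B C : Type) (u : M -> N) (h : B -> C) (s : seq (M * B)) :
  on_snd h [seq (u x.1, x.2) | x <- s] =
  [seq (u x.1, x.2) | x <- on_snd h s].
Proof. by rewrite /on_snd -!map_comp. Qed.

Lemma tens_eq_map (A B C : comPzRingType) (f : {rmorphism A -> B})
    (f' : {rmorphism A -> C}) (h : {rmorphism B -> C}) (M : lmodType A)
    (s t : seq (M * B)) :
  (forall a, f' a = h (f a)) -> tens_eq f s t ->
  tens_eq f' (on_snd h s) (on_snd h t).
Proof.
move=> f'E; elim=> {s t} [s|s t _|s t u _ IH1 _ IH2|s s' t t' _ IH1 _ IH2|s t|b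
    |m m' b|m b b'|a m b] /=.
- exact: TensRefl.
- exact: TensSym.
- exact: TensTrans IH1 IH2.
- by rewrite /on_snd !map_cat; apply: TensCat.
- by rewrite /on_snd !map_cat; apply: TensComm.
- exact: Tens0.
- exact: TensDl.
- by rewrite rmorphD; apply: TensDr.
- by rewrite rmorphM -f'E; apply: TensZ.
Qed.

Section Twist.
Variables (A A' : comPzRingType) (u : {rmorphism A' -> A}) (M : lmodType A).

(** The A-module M with scalars restricted along u. The vacuous [let] makes u
    a parameter of the type, so that the structure declared below is found. *)
Definition twist : Type := let _ := u in M.

HB.instance Definition _ := GRing.Zmodule.on twist.

Definition twist_scale (a : A') (m : twist) : twist := u a *: (m : M).

Lemma twist_scaleA a b m :
  twist_scale a (twist_scale b m) = twist_scale (a * b) m.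
Proof. by rewrite /twist_scale scalerA rmorphM. Qed.
Lemma twist_scale1 : left_id 1 twist_scale.
Proof. by move=> m; rewrite /twist_scale rmorph1 scale1r. Qed.
Lemma twist_scaleDr : right_distributive twist_scale +%R.
Proof. by move=> a m m'; apply: scalerDr. Qed.
Lemma twist_scaleDl m : {morph twist_scale^~ m : a b / a + b}.
Proof. by move=> a b; rewrite /twist_scale rmorphD scalerDl. Qed.

HB.instance Definition _ := GRing.Zmodule_isLmodule.Build A' twist
  twist_scaleA twist_scale1 twist_scaleDr twist_scaleDl.
End Twist.

Section TwistLinear.
Variables (A A' : comPzRingType) (u : {rmorphism A' -> A}).

Definition twist_fun (M N : lmodType A) (v : {linear M -> N}) :
  twist u M -> twist u N := v.

Lemma twist_fun_linear (M N : lmodType A) (v : {linear M -> N}) :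
  linear (twist_fun v).
Proof. by move=> a m m'; apply: (linearP v). Qed.

HB.instance Definition _ (M N : lmodType A) (v : {linear M -> N}) :=
  GRing.isLinear.Build A' (twist u M) (twist u N) _ (@twist_fun M N v)
    (twist_fun_linear v).

(** As u is onto, the relations a m (x) b = m (x) a b for a in A and those for
    the scalars of A' are the same. *)
Lemma tens_eq_twist (B : comPzRingType) (f : {rmorphism A -> B})
    (f' : {rmorphism A' -> B}) (M : lmodType A) (s t : seq (M * B)) :
  (forall a, f' a = f (u a)) -> bijective u ->
  @tens_eq A' B f' (twist u M) s t <-> tens_eq f s t.
Proof.
move=> f'E [v uK vK]; split.
- elim=> {s t} [s|s t _|s t w _ IH1 _ IH2|s s' t t' _ IH1 _ IH2|s t|b
      |m m' b|m b b'|a m b] /=.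
  + exact: TensRefl.
  + exact: TensSym.
  + exact: TensTrans IH1 IH2.
  + exact: TensCat.
  + exact: TensComm.
  + exact: Tens0.
  + exact: TensDl.
  + exact: TensDr.
  + by rewrite f'E; apply: TensZ.
- elim=> {s t} [s|s t _|s t w _ IH1 _ IH2|s s' t t' _ IH1 _ IH2|s t|b
      |m m' b|m b b'|a m b] /=.
  + exact: TensRefl.
  + exact: TensSym.
  + exact: TensTrans IH1 IH2.
  + exact: TensCat.
  + exact: TensComm.
  + exact: (@Tens0 _ _ _ (twist u M)).
  + exact: (@TensDl _ _ _ (twist u M)).
  + exact: TensDr.
  + have -> : f a = f' (v a) by rewrite f'E vK.
    by rewrite -{1}(vK a); apply: (@TensZ _ _ _ (twist u M)).
Qed.
End TwistLinear.

Lemma rmorphism_inv (A B : comPzRingType) (h : {rmorphism A -> B}) :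
  bijective h -> exists g : {rmorphism B -> A}, cancel h g /\ cancel g h.
Proof.
move=> [g hK gK].
have gB x y : g (x - y) = g x - g y by apply: (can_inj hK); rewrite rmorphB !gK.
have g1 : g 1 = 1 by apply: (can_inj hK); rewrite rmorph1 gK.
have gM x y : g (x * y) = g x * g y by apply: (can_inj hK); rewrite rmorphM !gK.
by exists (mk_rmorphism gB g1 gM).
Qed.

(** Over A', the algebra B is the algebra B over A with its scalars renamed:
    restrict the modules along the inverse of u to see it as such. *)
Lemma flat_hom_precomp (A A' B : comPzRingType) (u : {rmorphism A' -> A})
    (f : {rmorphism A -> B}) (f' : {rmorphism A' -> B}) :
  (forall a, f' a = f (u a)) -> bijective u -> flat_hom f -> flat_hom f'.
Proof.
move=> f'E /rmorphism_inv[v [uK vK]] ff M N w w_inj s t.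
have fE a : f a = f' (v a) by rewrite f'E vK.
have vb : bijective v by exists u.
have := ff (twist v M) (twist v N) (twist_fun (u := v) w) w_inj s t.
by rewrite !(tens_eq_twist _ _ fE vb); apply.
Qed.

Lemma flat_hom_factor (A B C : comPzRingType) (f : {rmorphism A -> B})
    (h : {rmorphism B -> C}) (f' : {rmorphism A -> C}) :
  (forall a, f' a = h (f a)) -> bijective h -> flat_hom f' -> flat_hom f.
Proof.
move=> f'E /rmorphism_inv[g [hK gK]] ff' M N u u_inj s t.
have fE a : f a = g (f' a) by rewrite f'E hK.
move=> /(tens_eq_map f'E); rewrite !on_snd_mapl => /(ff' _ _ u u_inj).
by move=> /(tens_eq_map fE); rewrite !(on_sndK hK).
Qed.

(** The ring D is the colimit of copies of C along the Frobenius of C, where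
    the n-th copy maps to D by c |-> g(c)^(1 / p^n). This is a map of B-algebras
    when B acts on the n-th copy through [fF n]. *)
Section FlatPerfection.
Variables (p : nat) (p_prime : prime p) (B C D : comPzRingType).
Variables (f : {rmorphism B -> C}) (g : {rmorphism C -> D})
  (h : {rmorphism B -> D}).
Hypotheses (hE : forall b, h b = g (f b)) (perfB : perfect_ring p B)
  (perfD : perfect_ring p D) (p0 : p%:R = 0 :> C) (rad : p_radicial p g).

Local Notation F := (frobn p_prime p0).
Let fF n : {rmorphism B -> C} := F n \o f.

Section Module.
Variable M : lmodType B.
Implicit Types (s t : seq (M * C)) (x y : seq (M * D)).

(* Transition from the k-th copy of C to the (k + n)-th copy. *)
Definition raise n s : seq (M * C) := on_snd (F n) s.

(** The tensor x is the image of s from the n-th copy of C; comparing p^n-th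
    powers avoids roots in D. *)
Definition lifts n s x : Prop :=
  on_snd g s = on_snd (fun d => d ^+ (p ^ n)) x.

Lemma lifts_raise n m s x : lifts n s x -> lifts (n + m) (raise m s) x.
Proof.
rewrite /lifts /raise /on_snd => e.
transitivity [seq (z.1, z.2 ^+ (p ^ m)) | z <- [seq (z.1, g z.2) | z <- s]].
  by rewrite -!map_comp; apply: eq_map => -[a b] /=; rewrite frobnE rmorphXn.
rewrite e -map_comp; apply: eq_map => -[a b] /=.
by rewrite -exprM expnD.
Qed.

Lemma lifts_exist x : exists n s, lifts n s x.
Proof.
elim: x => [|[m d] x [n [s e]]]; first by exists 0%N, [::].
have [k [c dc]] := rad.1 d.
exists (k + n)%N, ((m, F n c) :: raise k s); rewrite /lifts /=.
congr (_ :: _).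
  by rewrite frobnE rmorphXn -dc -exprM expnD.
by rewrite addnC; apply: lifts_raise.
Qed.

Lemma lifts_cat n s x y : lifts n s (x ++ y) ->
  exists s1 s2, [/\ s = s1 ++ s2, lifts n s1 x & lifts n s2 y].
Proof.
rewrite /lifts /on_snd => e; exists (take (size x) s), (drop (size x) s).
by rewrite cat_take_drop map_take map_drop e map_cat take_size_cat
  ?drop_size_cat ?size_map.
Qed.

Lemma raise_raise n m s : raise m (raise n s) = raise (m + n) s.
Proof.
by rewrite /raise /on_snd -map_comp; apply: eq_map => -[a b] /=; rewrite frobn_frobn.
Qed.

Lemma g_eq c c' : g c = g c' -> exists m, F m c = F m c'.
Proof.
move=> e; have [|m [d]] := rad.2 (c - c'); first by rewrite rmorphB e subrr.
rewrite p0 mul0r => e'; exists m.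
by apply/eqP; rewrite -subr_eq0 -rmorphB frobnE e'.
Qed.

Lemma raise_cat m s t : raise m (s ++ t) = raise m s ++ raise m t.
Proof. exact: map_cat. Qed.

(** Every element of the kernel of g is killed by a power of the Frobenius of C,
    and a list has finitely many entries. *)
Lemma on_snd_g_eq s t : on_snd g s = on_snd g t ->
  exists m, raise m s = raise m t.
Proof.
elim: s t => [|[a c] s IH] [|[a' c'] t] /=.
  by exists 0%N.
  by [].
  by [].
move=> [-> /g_eq[m e] /IH[m' e']]; exists (m + m')%N.
by rewrite -!(raise_raise m' m) e' addnC -!frobn_frobn e.
Qed.

Lemma tens_eq_raise n m s t : tens_eq (fF n) s t ->
  tens_eq (fF (n + m)) (raise m s) (raise m t).
Proof.
by apply: tens_eq_map => b /=; rewrite frobn_frobn addnC.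
Qed.

(** The tensor product commutes with the colimit: each of the finitely many
    elementary relations that prove an equality over D holds in some copy of C,
    for whatever lifts of its two sides. *)
Lemma tens_eq_descend x y : tens_eq h x y ->
  forall n s t, lifts n s x -> lifts n t y ->
  exists m, tens_eq (fF (n + m)) (raise m s) (raise m t).
Proof.
elim=> {x y} [x|x y _ IH|x y z _ IH1 _ IH2|x x' y y' _ IH1 _ IH2|x y|b
    |a a' b|a b b'|b a d] n s t.
- move=> ls lt; have [m e] := on_snd_g_eq (etrans ls (esym lt)).
  by exists m; rewrite e; apply: TensRefl.
- by move=> ls lt; have [m e] := IH n t s lt ls; exists m; apply: TensSym.
- (* The middle term may live in a later copy than the two ends. *)
  move=> ls lt; have [k [u lu]] := lifts_exist y.
  have := lifts_raise n lu; rewrite addnC => lu'.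
  have [m1 e1] := IH1 _ _ _ (lifts_raise k ls) lu'.
  have [m2 e2] := IH2 _ _ _ lu' (lifts_raise k lt).
  exists (m1 + m2 + k)%N; rewrite -!(raise_raise k) (addnC _ k) addnA.
  have e12 : tens_eq (fF (n + k + (m1 + m2)))
      (raise (m1 + m2) (raise k s))
      (raise (m1 + m2) (raise n u)).
    rewrite addnA (addnC m1) -!(raise_raise m1 m2).
    exact: tens_eq_raise e1.
  apply: TensTrans e12 _; rewrite -!(raise_raise m2 m1) (addnC m1) addnA.
  exact: tens_eq_raise e2.
- move=> /lifts_cat[s1 [s2 [-> l1 l2]]] /lifts_cat[t1 [t2 [-> l1' l2']]].
  have [m1 e1] := IH1 _ _ _ l1 l1'; have [m2 e2] := IH2 _ _ _ l2 l2'.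
  exists (m1 + m2)%N; rewrite !raise_cat.
  apply: TensCat.
    rewrite addnA (addnC m1) -!(raise_raise m1 m2).
    exact: tens_eq_raise e1.
  rewrite -!(raise_raise m2 m1) (addnC m1) addnA.
  exact: tens_eq_raise e2.
- move=> /lifts_cat[s1 [s2 [-> l1 l2]]] /lifts_cat[t2 [t1 [-> l2' l1']]].
  have [m1 e1] := on_snd_g_eq (etrans l1 (esym l1')).
  have [m2 e2] := on_snd_g_eq (etrans l2 (esym l2')).
  exists (m1 + m2)%N; rewrite !raise_cat.
  rewrite -!(raise_raise m2 m1) -e2 !raise_raise (addnC m1).
  rewrite -!(raise_raise m1 m2) -e1.
  exact: TensComm.
- case: s t => [|[a c] []] // [] // [+ _] _ => ->; exists 0%N; exact: Tens0.
- case: s t => [|[a0 c] []] // [|[a1 c1] [|[a2 c2] []]] //= [-> e] [-> e1 -> e2].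
  have [|m1 f1] := @g_eq c c1; first by rewrite e.
  have [|m2 f2] := @g_eq c c2; first by rewrite e.
  exists (m1 + m2)%N => /=.
  rewrite -(frobn_frobn _ _ m1 m2 c2) -f2 frobn_frobn (addnC m1).
  rewrite -(frobn_frobn _ _ m2 m1 c1) -f1 frobn_frobn.
  exact: TensDl.
- case: s t => [|[a0 c] []] // [|[a1 c1] [|[a2 c2] []]] //= [-> e] [-> e1 -> e2].
  have [|m e3] := @g_eq c (c1 + c2).
    by rewrite e rmorphD e1 e2 -!(frobnE p_prime perfD.1) rmorphD.
  by exists m; rewrite /= e3 rmorphD; apply: TensDr.
- case: s t => [|[a0 c] []] // [|[a1 c1] []] //= [-> e] [-> e1].
  have [|m e3] := @g_eq c1 (F n (f b) * c).
    by rewrite rmorphM e e1 exprMn frobnE rmorphXn hE.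
  exists m; rewrite /= e3 rmorphM frobn_frobn addnC.
  exact: TensZ.
Qed.
End Module.

(** Each copy of C is flat over B, because [fF n] is f composed with a power of
    the Frobenius of B, an automorphism. An equality in N (x) D between tensors
    from M descends to a copy of C, where it can be tested in M. *)
Lemma flat_perfection : flat_hom f -> flat_hom h.
Proof.
move=> ff M N u u_inj x y xy.
have [n1 [s1 l1]] := lifts_exist x; have [n2 [t1 l2]] := lifts_exist y.
have ls := lifts_raise n2 l1; have := lifts_raise n1 l2.
rewrite addnC => lt; move: (n1 + n2)%N (raise _ s1) (raise _ t1) ls lt.
move=> n s t ls lt {n1 n2 s1 t1 l1 l2}.
have lu r z : lifts n r z ->
    lifts n [seq (u x.1, x.2) | x <- r] [seq (u x.1, x.2) | x <- z].
  by rewrite /lifts !on_snd_mapl => ->.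
have [m] := tens_eq_descend xy (lu _ _ ls) (lu _ _ lt).
have fE b : fF (n + m) b = f (frobn p_prime perfB.1 (n + m) b).
  by rewrite /= !frobnE rmorphXn.
have ub : bijective (frobn p_prime perfB.1 (n + m)).
  by apply: (eq_bij (perfect_bij (n + m) perfB)) => b; rewrite frobnE.
rewrite /raise !on_snd_mapl -!/(raise _ _) => /(flat_hom_precomp fE ub ff u_inj).
have [r [rK Kr]] : exists r : {rmorphism D -> D},
    cancel (frobn p_prime perfD.1 (n + m)) r /\
    cancel r (frobn p_prime perfD.1 (n + m)).
  apply: rmorphism_inv.
  by apply: (eq_bij (perfect_bij (n + m) perfD)) => b; rewrite frobnE.
have hfF b : h b = (r \o g) (fF (n + m) b).
  by rewrite /= frobnE rmorphXn -(frobnE p_prime perfD.1) rK hE.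
move=> /(tens_eq_map hfF).
have lK (r' : seq (M * C)) (z : seq (M * D)) :
    lifts (n + m) r' z -> on_snd (r \o g) r' = z.
  move=> l; transitivity (on_snd r (on_snd g r')).
    by rewrite /on_snd -map_comp.
  rewrite l -[RHS](on_sndK rK); congr on_snd.
  by apply: eq_map => -[c d] /=; rewrite frobnE.
by rewrite (lK _ _ (lifts_raise m ls)) (lK _ _ (lifts_raise m lt)).
Qed.
End FlatPerfection.

(** * Functoriality of the spectrum, on points and stalks *)

(* Fractions in localizations, not in fraction fields. *)
Local Notation frac := Defs.frac.

Lemma nprimeX (A : comPzRingType) (P : primeIdeal A) a n :
  ~ pset P a -> ~ pset P (a ^+ n).
Proof.
move=> na; elim: n => [|n IH]; first by rewrite expr0; apply: prime1.
by rewrite exprS; apply: nprimeM.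
Qed.

Definition basic_opens (A : comPzRingType) (a : A) : opens (spec_top A) :=
  Opens (@open_basic A a).

Section SpecStalk.
Variables (A : comPzRingType) (P : spec_rs A).

(** The fraction a / d as a germ, defined on the open set where d does not
    vanish: this identifies the stalk at P with the localization at P. *)
Definition sfrac (a d : A) (Pd : ~ pset (P : spec_point A) d) :
    stalk (spec_rs A) P :=
  @germ (spec_rs A) P (basic_opens d) Pd
    (@spec_frac A (basic_opens d) a d (fun q h => h)).

Lemma spec_germ_frac (U : opens (spec_top A)) (UP : oset U P) a d
    (hd : forall q, oset U q -> ~ pset q d) :
  @germ (spec_rs A) P U UP (spec_frac a hd) = sfrac a (hd P UP).
Proof.
have h : U `<=` basic_opens d by move=> q /hd.
rewrite /sfrac -(germ_res (X := spec_rs A) _ UP h); congr germ.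
by apply: spec_ext => q Uq; rewrite spec_resE !mk_spec_sectionE; apply: fracE.
Qed.

Lemma sfrac_ind (T : stalk (spec_rs A) P -> Prop) :
  (forall a d (Pd : ~ pset (P : spec_point A) d), T (sfrac a Pd)) ->
  forall x, T x.
Proof.
by move=> Tf x; have [U [UP [a [d [hd ->]]]]] := spec_stalk_frac x;
  rewrite spec_germ_frac.
Qed.

Lemma sfracP a d (Pd : ~ pset (P : spec_point A) d)
    b e (Pe : ~ pset (P : spec_point A) e) :
  sfrac a Pd = sfrac b Pe <->
  exists2 t, ~ pset (P : spec_point A) t & t * (a * e) = t * (b * d).
Proof.
split=> [/germP[W [h [h' [WP E]]]]|[t Pt E]].
  have := congr1 (fun s => @spec_val A W s P WP) E.
  by cbv beta; rewrite !spec_resE !mk_spec_sectionE => /fracP.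
apply/germP.
pose W := oI (oI (basic_opens d) (basic_opens e))
  (basic_opens t).
have h : W `<=` basic_opens d by move=> q [[]].
have h' : W `<=` basic_opens e by move=> q [[]].
exists W, h, h'; split=> //; apply: spec_ext => q Wq.
by rewrite !spec_resE !mk_spec_sectionE; apply/fracP; exists t => //; case: Wq.
Qed.

Lemma sfracM a d (Pd : ~ pset (P : spec_point A) d)
    b e (Pe : ~ pset (P : spec_point A) e) :
  sfrac a Pd * sfrac b Pe = sfrac (a * b) (nprimeM Pd Pe).
Proof.
pose W := oI (basic_opens d) (basic_opens e).
have hd : W `<=` basic_opens d by move=> q [].
have he : W `<=` basic_opens e by move=> q [].
have WP : oset W P by [].
have hde q : oset W q -> ~ pset q (d * e) by move=> []; apply: nprimeM.
rewrite {1 2}/sfrac -(germ_res (X := spec_rs A) _ WP hd).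
rewrite -(germ_res (X := spec_rs A) _ WP he).
rewrite -germM (_ : _ * _ = spec_frac (a * b) hde).
  by rewrite spec_germ_frac; apply/sfracP; exists 1 => //; exact: prime1.
apply: spec_ext => q Wq; rewrite spec_valM !spec_resE !mk_spec_sectionE fracM.
exact: fracE.
Qed.

Lemma sfracD a b d (Pd : ~ pset (P : spec_point A) d) :
  sfrac a Pd + sfrac b Pd = sfrac (a + b) Pd.
Proof.
rewrite -germD; congr germ; apply: spec_ext => q Wq.
rewrite spec_valD !mk_spec_sectionE fracD; apply: fracE.
by ring.
Qed.

Lemma sfrac0 d (Pd : ~ pset (P : spec_point A) d) : sfrac 0 Pd = 0.
Proof. by apply: (@addrI _ (sfrac 0 Pd)); rewrite sfracD !addr0. Qed.

Lemma sfrac1 : sfrac 1 (@prime1 _ P) = 1.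
Proof.
have TP : oset (oT (spec_rs A)) P by [].
rewrite -(germ1 TP) (_ : 1 = spec_frac 1 (fun q (_ : oset (oT _) q) => @prime1 _ q)).
  by rewrite spec_germ_frac; apply/sfracP; exists 1 => //; exact: prime1.
by apply: spec_ext => q Wq; rewrite mk_spec_sectionE spec_val1 frac1.
Qed.

Lemma sfracX a d (Pd : ~ pset (P : spec_point A) d) n :
  sfrac a Pd ^+ n = sfrac (a ^+ n) (nprimeX (n := n) Pd).
Proof.
elim: n => [|n IH].
  rewrite expr0 -sfrac1; apply/sfracP; exists 1; rewrite ?expr0 //.
  exact: prime1.
rewrite exprS IH sfracM; apply/sfracP; exists 1; first exact: prime1.
by rewrite !exprS.
Qed.

Lemma sfrac_nat n : sfrac n%:R (@prime1 _ P) = n%:R.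
Proof.
elim: n => [|n IH]; first exact: sfrac0.
by rewrite !mulrS -sfracD IH sfrac1.
Qed.

Lemma sfrac_unit a d (Pd : ~ pset (P : spec_point A) d) :
  is_unit (sfrac a Pd) <-> ~ pset (P : spec_point A) a.
Proof. exact: spec_stalk_unit. Qed.
End SpecStalk.

Section SpecMap.
Variables (A B : comPzRingType) (g : {rmorphism A -> B}).

Section Preimage.
Variable P : primeIdeal B.

Lemma preim0 : pset P (g 0).
Proof. by rewrite rmorph0; apply: prime0. Qed.
Lemma preimD a b : pset P (g a) -> pset P (g b) -> pset P (g (a + b)).
Proof. by rewrite rmorphD; apply: primeD. Qed.
Lemma preimMr a b : pset P (g b) -> pset P (g (a * b)).
Proof. by rewrite rmorphM; apply: primeMr. Qed.
Lemma preim1 : ~ pset P (g 1).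
Proof. by rewrite rmorph1; apply: prime1. Qed.
Lemma preimM a b : pset P (g (a * b)) -> pset P (g a) \/ pset P (g b).
Proof. by rewrite rmorphM; apply: primeM. Qed.

Definition spec_preim : primeIdeal A :=
  @PrimeIdeal A (fun a => pset P (g a)) preim0 preimD preimMr preim1 preimM.

Definition loc_map (x : localization spec_preim) : localization P :=
  frac (g (fr_num (qrepr x))) (@fr_denP _ _ (qrepr x) : ~ pset P (g _)).

Lemma loc_map_frac a d (hd : ~ pset spec_preim d) :
  loc_map (frac a hd) = frac (g a) (hd : ~ pset P (g d)).
Proof.
rewrite /loc_map; set r := qrepr _.
have [t nt e] : frac_eq r (FracRep a hd) :=
  @qrepr_eq (frac_setoid spec_preim) (FracRep a hd).
apply/fracP; exists (g t) => //.
by rewrite -!rmorphM e.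
Qed.

Lemma loc_mapB x y : loc_map (x - y) = loc_map x - loc_map y.
Proof.
elim/localization_ind: x => a d hd; elim/localization_ind: y => b e he.
rewrite fracN fracD !loc_map_frac fracN fracD; apply: fracE.
by rewrite !(rmorphD, rmorphN, rmorphM).
Qed.
Lemma loc_mapM x y : loc_map (x * y) = loc_map x * loc_map y.
Proof.
elim/localization_ind: x => a d hd; elim/localization_ind: y => b e he.
rewrite fracM !loc_map_frac fracM; apply: fracE.
by rewrite !rmorphM.
Qed.
Lemma loc_map1 : loc_map 1 = 1.
Proof. by rewrite -frac1 loc_map_frac -frac1; apply: fracE; rewrite rmorph1. Qed.
End Preimage.

Definition spec_point_map (P : spec_top B) : spec_top A := spec_preim P.

Lemma spec_point_map_continuous : continuous spec_point_map.
Proof.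
apply/continuousP => U /spec_openP oU; apply/spec_openP => P /oU[f fP fU].
by exists (g f) => // Q gQ; apply: fU.
Qed.

Section Pull.
Variables (V : opens (Spec A)) (U : opens (Spec B)).
Hypothesis h : U `<=` spec_point_map @^-1` V.

Lemma spec_pull_subproof (s : spec_sheaf V) (P : spec_top B) (UP : oset U P) :
  exists W : opens (spec_top B), [/\ oset W P, W `<=` U &
  exists a d : B, forall Q (UQ : oset U Q), oset W Q ->
    exists dQ : ~ pset Q d,
      loc_map (spec_val s (h UQ : oset V (spec_point_map Q))) = frac a dQ].
Proof.
have [W [WP WV [a [d e]]]] := spec_valP s (h UP : oset V (spec_point_map P)).
exists (oI U (opre spec_point_map_continuous W)); split=> //.
  by move=> Q [].
exists (g a), (g d) => Q UQ [_ WQ].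
have [dQ ->] := e _ (h UQ : oset V (spec_point_map Q)) WQ.
by exists dQ; rewrite loc_map_frac.
Qed.

Definition spec_pull_fun (s : sheaf (Spec A) V) : sheaf (Spec B) U :=
  mk_spec_section (spec_pull_subproof s).

Lemma spec_pull_funE s P (UP : oset U P) :
  spec_val (spec_pull_fun s) UP =
  loc_map (spec_val s (h UP : oset V (spec_point_map P))).
Proof. by []. Qed.

Lemma spec_pull_funB s t :
  spec_pull_fun (s - t) = spec_pull_fun s - spec_pull_fun t.
Proof.
by apply: spec_ext => P UP; rewrite spec_valB !spec_pull_funE spec_valB loc_mapB.
Qed.
Lemma spec_pull_funM s t :
  spec_pull_fun (s * t) = spec_pull_fun s * spec_pull_fun t.
Proof.
by apply: spec_ext => P UP; rewrite spec_valM !spec_pull_funE spec_valM loc_mapM.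
Qed.
Lemma spec_pull_fun1 : spec_pull_fun 1 = 1.
Proof.
by apply: spec_ext => P UP; rewrite spec_pull_funE !spec_val1 loc_map1.
Qed.

Definition spec_pull : {rmorphism sheaf (Spec A) V -> sheaf (Spec B) U} :=
  mk_rmorphism spec_pull_funB spec_pull_fun1 spec_pull_funM.
End Pull.

Lemma spec_pull_res (V V' : opens (Spec A)) (U U' : opens (Spec B))
    (h : U `<=` spec_point_map @^-1` V) (h' : U' `<=` spec_point_map @^-1` V')
    (hV : V' `<=` V) (hU : U' `<=` U) s :
  res (Spec B) hU (spec_pull h s) = spec_pull h' (res (Spec A) hV s).
Proof.
apply: spec_ext => P UP.
exact: (congr1 (@loc_map P)
  (spec_val_irr s (h P (hU P UP)) (hV (spec_point_map P) (h' P UP)))).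
Qed.

Definition spec_rs_map : rsMor (Spec B) (Spec A) :=
  @RSMor (Spec B) (Spec A) spec_point_map spec_point_map_continuous
    spec_pull spec_pull_res.

Lemma stalk_map_sfrac (P : Spec B) a d
    (hd : ~ pset (spec_point_map P : spec_point A) d) :
  stalk_map spec_rs_map P (sfrac a hd) =
  @sfrac B P (g a) (g d) hd.
Proof.
have h : basic_opens (g d) `<=` spec_rs_map @^-1` basic_opens d.
  by [].
rewrite (@stalk_map_germ _ _ spec_rs_map P (basic_opens d)
  (basic_opens (g d)) hd hd h).
congr germ; apply: spec_ext => Q UQ.
apply: etrans (@loc_map_frac Q a d (h Q UQ)) _.
rewrite mk_spec_sectionE; exact: fracE.
Qed.

Lemma spec_map_local (P : Spec B) : local_hom (stalk_map spec_rs_map P).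
Proof.
elim/sfrac_ind => a d hd; rewrite stalk_map_sfrac => /sfrac_unit ga.
exact/sfrac_unit.
Qed.

Definition spec_map : lrMor (Spec B) (Spec A) := LRMor spec_map_local.

(** Numerators and denominators of fractions over B have p-powers that come
    from A, and such a p-power of a denominator comes from outside the preimage
    of P. So does a p-power of an element outside P that kills the image of a
    numerator, and this gives the statement on the kernel. *)
Lemma stalk_map_radicial p (P : Spec B) :
  prime p -> p_radicial p g -> p_radicial p (stalk_map spec_map P).
Proof.
move=> p_prime [sur ker]; split.
  elim/sfrac_ind => b e he.
  have [n [a ba]] := sur b; have [m [d ed]] := sur e.
  have hd : ~ pset (spec_preim P) (d ^+ (p ^ n)).
    by rewrite /= rmorphXn -ed -exprM; apply: nprimeX.
  exists (n + m)%N, (@sfrac A (spec_point_map P) (a ^+ (p ^ m)) _ hd).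
  rewrite sfracX stalk_map_sfrac; apply/sfracP; exists 1; first exact: prime1.
  by rewrite !rmorphXn -ba -ed -!exprM -!expnD addnC.
elim/sfrac_ind => a d hd; rewrite stalk_map_sfrac -(sfrac0 (@prime1 _ P)).
move=> /sfracP[t nt]; rewrite mul0r mulr0 mulr1 => tga.
have [n [u tu]] := sur t.
have [|m [c uac]] := ker (u * a ^+ (p ^ n)).
  rewrite rmorphM rmorphXn -tu -exprMn tga expr0n expn_eq0.
  by rewrite -leqn0 leqNgt prime_gt0.
have hu : ~ pset (spec_preim P) u by rewrite /= -tu; apply: nprimeX.
exists (n + m)%N.
exists (@sfrac A (spec_point_map P) c _
  (nprimeM (nprimeX (n := p ^ m) hu) (nprimeX (n := p ^ (n + m)) hd))).
rewrite -sfrac_nat sfracM sfracX; apply/sfracP; exists 1; first exact: prime1.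
rewrite !mul1r -uac exprMn -exprM -expnD; ring.
Qed.
End SpecMap.

(** * Perfect schemes *)

Lemma primeX (A : comPzRingType) (P : primeIdeal A) a n :
  pset P (a ^+ n) -> pset P a.
Proof. by move=> Pan; apply: contrapT => /(nprimeX (n := n)); apply. Qed.

Lemma primeXr (A : comPzRingType) (P : primeIdeal A) a n :
  (0 < n)%N -> pset P a -> pset P (a ^+ n).
Proof. by case: n => // n _ Pa; rewrite exprSr; apply: primeMr. Qed.

Lemma primeIdeal_ext (A : comPzRingType) (P Q : primeIdeal A) :
  (pset P : set A) = pset Q -> P = Q.
Proof.
case: P Q => P P0 PD PMr P1 PM [Q Q0 QD QMr Q1 QM] /= PQ; subst Q.
by congr PrimeIdeal; apply: Prop_irrelevance.
Qed.

Lemma germ_nat (X : ringedSpace) (x : X) (U : opens X) (Ux : oset U x) n :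
  germ Ux n%:R = n%:R.
Proof.
by elim: n => [|n IH]; rewrite ?germ0 // !mulrS germD germ1 IH.
Qed.

Lemma germX (X : ringedSpace) (x : X) (U : opens X) (Ux : oset U x) s n :
  germ Ux (s ^+ n) = germ Ux s ^+ n.
Proof.
by elim: n => [|n IH]; rewrite ?expr0 ?germ1 // !exprS germM IH.
Qed.

(** Primes of A that contain p extend to D: the prime over Q consists of the
    elements of D with a p-power in the image of Q. By [over_predP], any
    p-power that comes from A can be used to test this. *)
Section SpecSurjective.
Variables (p : nat) (p_prime : prime p) (A D : comPzRingType).
Variables (g : {rmorphism A -> D}) (D0 : p%:R = 0 :> D) (rad : p_radicial p g).
Variables (Q : primeIdeal A) (Qp : pset Q p%:R).

Let p_gt0 n : (0 < p ^ n)%N. Proof. by rewrite expn_gt0 prime_gt0. Qed.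

Definition over_pred (d : D) : Prop :=
  exists n a, d ^+ (p ^ n) = g a /\ pset Q a.

Lemma over_predP d n a : d ^+ (p ^ n) = g a -> over_pred d <-> pset Q a.
Proof.
move=> da; split=> [[m [b [db Qb]]]|Qa]; last by exists n, a.
have [|l [c e]] := rad.2 (a ^+ (p ^ m) - b ^+ (p ^ n)).
  by rewrite rmorphB !rmorphXn -da -db -!exprM mulnC subrr.
have /primeX Qab : pset Q ((a ^+ (p ^ m) - b ^+ (p ^ n)) ^+ (p ^ l)).
  by rewrite e mulrC; apply: primeMr.
apply: (@primeX _ _ _ (p ^ m)); rewrite -(subrK (b ^+ (p ^ n)) (a ^+ _)).
by apply: primeD => //; apply: primeXr; rewrite // p_gt0.
Qed.

Lemma over_pred0 : over_pred 0.
Proof. by apply/(@over_predP 0 0 0); rewrite ?rmorph0 //; apply: prime0. Qed.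

Lemma over_pred1 : ~ over_pred 1.
Proof.
by move=> /(@over_predP 1 0 1); rewrite rmorph1 expr1n => /(_ erefl)/prime1.
Qed.

Lemma over_predD d e : over_pred d -> over_pred e -> over_pred (d + e).
Proof.
move=> [n [a [da Qa]]] [m [b [eb Qb]]].
exists (n + m)%N, (a ^+ (p ^ m) + b ^+ (p ^ n)); split.
  rewrite rmorphD !rmorphXn -da -eb -!exprM -!expnD (addnC m).
  by rewrite -!(frobnE p_prime D0) rmorphD.
by apply: primeD; apply: primeXr; rewrite ?p_gt0.
Qed.

Lemma over_predM d e : over_pred (d * e) <-> over_pred d \/ over_pred e.
Proof.
have [n [a da]] := rad.1 d; have [m [b eb]] := rad.1 e.
have E : (d * e) ^+ (p ^ (n + m)) = g (a ^+ (p ^ m) * b ^+ (p ^ n)).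
  by rewrite exprMn rmorphM !rmorphXn -da -eb -!exprM -!expnD (addnC m).
rewrite (over_predP E) (over_predP da) (over_predP eb); split.
  by move=> /primeM[]/primeX; [left|right].
case=> Qx; last by apply/primeMr/primeXr; rewrite ?p_gt0.
by rewrite mulrC; apply/primeMr/primeXr; rewrite ?p_gt0.
Qed.

Lemma over_predMr d e : over_pred e -> over_pred (d * e).
Proof. by move=> oe; apply/over_predM; right. Qed.

Definition over_prime : primeIdeal D :=
  PrimeIdeal over_pred0 over_predD over_predMr over_pred1
    (fun d e => (over_predM d e).1).

Lemma spec_preim_over : spec_preim g over_prime = Q.
Proof.
apply: primeIdeal_ext; apply/seteqP; split=> a /=.
  by move=> /(@over_predP (g a) 0 a); apply; rewrite expn0 expr1.
by move=> Qa; apply/(@over_predP (g a) 0 a); rewrite ?expn0 ?expr1.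
Qed.
End SpecSurjective.

(** A prime Q of A contains p, for otherwise p would be invertible in the
    stalk at Q, where it is 0. *)
Lemma spec_map_perfection_surj p (p_prime : prime p) (A : comPzRingType)
    (Q : Spec A) : Fp_scheme p (Spec A) ->
  exists P, spec_map (to_perfection p_prime A) P = Q.
Proof.
move=> hA.
have Qp : pset (Q : spec_point A) p%:R.
  apply: contrapT => /(sfrac_unit _ (@prime1 _ Q)).
  rewrite sfrac_nat -(germ_nat (Logic.I : oset (oT (Spec A)) Q)).
  rewrite (natr_Fp_scheme _ p_prime hA) germ0 => -[b]; rewrite mul0r => /esym.
  by case: (@lr_local (Spec A) Q).
have [D0 _] := perfection_perfect p_prime A.
exists (over_prime p_prime D0 (to_perfection_radicial p_prime A) Qp).
exact: spec_preim_over.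
Qed.

Section PerfectScheme.
Variables (p : nat) (p_prime : prime p).

(** Transfers an identity of endomorphisms to sections without a transport along
    the equality of the underlying maps. *)
Lemma lr_id_pull (X : lrSpace) (f : lrMor X X) : f = lr_id X ->
  forall (V U : opens X) (h : U `<=` f @^-1` V) (h' : U `<=` V) s,
    pull f h s = res X h' s.
Proof. by move=> -> V U h h' s; apply: res_irr. Qed.

(** The Frobenius is the identity on points, and the p-th power on sections;
    so the action on sections of its inverse extracts p-th roots. *)
Lemma perfect_scheme_sections (X : scheme) (U : opens X) :
  perfect_scheme p_prime X -> perfect_ring p (sheaf X U).
Proof.
move=> [hX [g [gf _]]]; split; first exact: natr_Fp_scheme.
have gE x : g x = x.
  exact: (congr1 (fun f : lrMor X X => f x) gf).
have h : U `<=` (fun x => g x) @^-1` U by move=> x; rewrite /preimage /= gE.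
have hU : U `<=` opre (@rs_cont _ _ g) U by [].
pose r (s : sheaf X U) : sheaf X U :=
  res X hU (pull g (@opre_sub _ _ _ (@rs_cont _ _ g) U) s).
have rK s : r s ^+ p = s.
  have := lr_id_pull gf h (@subset_refl _ U) s; rewrite res_id => {2}<-.
  rewrite /r /= /comp_pull /= /rmor_fun /frob_fun; congr (_ ^+ p).
  exact: res_irr.
exists r => [s|s]; last exact: rK.
by rewrite -[RHS]rK /r !rmorphXn.
Qed.

Lemma perfect_stalk (X : ringedSpace) (x : X) :
  (forall U : opens X, perfect_ring p (sheaf X U)) ->
  perfect_ring p (stalk X x).
Proof.
move=> perf; split.
  by rewrite -(germ_nat (Logic.I : oset (oT X) x)) (perf (oT X)).1 germ0.
apply: bijP => [a b|a].
  elim/stalk_ind2: a / b => U Ux s t; rewrite -!germX => /germP[W [h [h' [Wx]]]].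
  rewrite !rmorphXn => /(bij_inj (perf W).2) e.
  by apply/germP; exists W, h, h'.
elim/stalk_ind: a => U Ux s; have [r _ rK] := (perf U).2.
by exists (germ Ux (r s)); rewrite -germX rK.
Qed.

(** Conversely, unique p-th roots of sections are compatible with restriction
    and define an inverse of the Frobenius. *)
Section InverseFrobenius.
Variables (X : lrSpace) (hX : Fp_scheme p X).
Hypothesis perf : forall U : opens X, perfect_ring p (sheaf X U).

Lemma frob_root_ex (U : opens X) : exists r : {rmorphism sheaf X U -> sheaf X U},
  cancel (fun s => s ^+ p) r /\ cancel r (fun s => s ^+ p).
Proof.
have [] := @rmorphism_inv _ _ (frobn p_prime (perf U).1 1).
  by apply: eq_bij (perf U).2 _ _ => s; rewrite frobnE expn1.
move=> r [rK Kr]; exists r; split=> s.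
  by rewrite -[RHS]rK frobnE expn1.
by rewrite -[RHS]Kr frobnE expn1.
Qed.

Definition frob_root (U : opens X) := sval (cid (frob_root_ex U)).

Lemma frob_rootK U : cancel (fun s => s ^+ p) (frob_root U).
Proof. by case: (svalP (cid (frob_root_ex U))). Qed.

Lemma frob_rootVK U : cancel (frob_root U) (fun s => s ^+ p).
Proof. by case: (svalP (cid (frob_root_ex U))). Qed.

Definition frob_root_pull (V U : opens X) (h : U `<=` (fun x : X => x) @^-1` V) :
  {rmorphism sheaf X V -> sheaf X U} := frob_root U \o res X (h : U `<=` V).

Lemma frob_root_pull_res (V V' U U' : opens X) (h : U `<=` (fun x : X => x) @^-1` V)
    (h' : U' `<=` (fun x : X => x) @^-1` V') (hV : V' `<=` V) (hU : U' `<=` U)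
    s : res X hU (frob_root_pull h s) = frob_root_pull h' (res X hV s).
Proof.
apply: (can_inj (@frob_rootK U')); rewrite -rmorphXn /= !frob_rootVK !resE.
exact: res_irr.
Qed.

Definition frob_root_rs : rsMor X X :=
  @RSMor X X (fun x => x) (@id_continuous X) frob_root_pull frob_root_pull_res.

Lemma frob_root_local x : local_hom (stalk_map frob_root_rs x).
Proof.
move=> a; elim/stalk_ind: a => U Ux s.
rewrite (@stalk_map_germ _ _ frob_root_rs x U U Ux Ux (@subset_refl _ _)) => -[b ab].
exists (b ^+ p).
have <- : germ Ux (frob_root U s) ^+ p = germ Ux s by rewrite -germX frob_rootVK.
by rewrite -exprMn -[RHS](expr1n _ p) -ab /= res_id.
Qed.

Lemma frobenius_iso : lr_iso (frobenius p_prime hX).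
Proof.
exists (LRMor frob_root_local); split; apply: lrMor_ext => // V U hf hg s.
  pose W := opre (@rs_cont _ _ frob_root_rs) V.
  pose hW : W `<=` V := @opre_sub _ _ _ (@rs_cont _ _ frob_root_rs) V.
  apply: etrans (_ : res X (hf : U `<=` W) (frob_root W (res X hW s)) ^+ p = _).
    by [].
  by rewrite -rmorphXn frob_rootVK resE; apply: res_irr.
pose W := opre (@id_continuous X) V.
pose hW : W `<=` V := @opre_sub _ _ _ (@id_continuous X) V.
apply: etrans (_ : frob_root U (res X (hf : U `<=` W) (res X hW s ^+ p)) = _).
  by [].
by rewrite rmorphXn frob_rootK resE; apply: res_irr.
Qed.
End InverseFrobenius.


Section SpecPerfect.
Variables (D : comPzRingType) (perf : perfect_ring p D).

Lemma fracX (P : primeIdeal D) a d (Pd : ~ pset P d) n :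
  frac a Pd ^+ n = frac (a ^+ n) (nprimeX (n := n) Pd).
Proof.
elim: n => [|n IH].
  by rewrite expr0 -frac1; apply: fracE; rewrite !expr0.
by rewrite exprS IH fracM; apply: fracE; rewrite !exprS.
Qed.

Let pS : p = p.-1.+1. Proof. by rewrite prednK ?prime_gt0. Qed.

Lemma loc_frob_inj (P : primeIdeal D) (x y : localization P) :
  x ^+ p = y ^+ p -> x = y.
Proof.
have [_ [r rK _]] := perf.
elim/localization_ind: x => a d hd; elim/localization_ind: y => b e he.
rewrite !fracX => /fracP[t Pt E]; apply/fracP; exists t => //.
apply: (can_inj rK); rewrite /= !exprMn.
have -> : t ^+ p = t ^+ p.-1 * t by rewrite -exprSr -pS.
by rewrite -!(mulrA (t ^+ _)) E.
Qed.

(** Writing a / d as (a d^(p - 1)) / d^p leaves only the numerator without an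
    evident p-th root. *)
Lemma frac_root (P : primeIdeal D) a d (Pd : ~ pset P d) b :
  b ^+ p = a * d ^+ p.-1 -> frac b Pd ^+ p = frac a Pd.
Proof.
move=> e; rewrite fracX; apply: fracE.
by rewrite e -mulrA -exprSr -pS.
Qed.

Lemma spec_valX (U : opens (spec_top D)) (s : spec_sheaf U) P (UP : oset U P) n :
  spec_val (s ^+ n) UP = spec_val s UP ^+ n.
Proof.
by elim: n => [|n IH]; rewrite ?expr0 ?spec_val1 // !exprS spec_valM IH.
Qed.

(** Roots are unique in every localization, so the pointwise roots of a section
    are represented locally by the fractions of [frac_root]. *)
Lemma Spec_sections_perfect (U : opens (Spec D)) :
  bijective (fun s : sheaf (Spec D) U => s ^+ p).
Proof.
have [_ [r rK Kr]] := perf.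
apply: bijP => [s t st|s].
  apply: spec_ext => P UP; apply: loc_frob_inj.
  rewrite -!spec_valX.
  exact: (congr1 (fun z : spec_sheaf U => spec_val z UP) st).
have rt (P : spec_top D) (UP : oset U P) :
    {y | y ^+ p = @spec_val D U s P UP}.
  apply: cid; elim/localization_ind: (spec_val s UP) => a d hd.
  by exists (frac (r (a * d ^+ p.-1)) hd); apply: frac_root.
have hf (P : spec_top D) (UP : oset U P) :
    exists V : opens (spec_top D), [/\ oset V P, V `<=` U &
    exists a d : D, forall Q (UQ : oset U Q), oset V Q ->
      exists dQ : ~ pset Q d, sval (rt Q UQ) = frac a dQ].
  have [V [VP VU [a [d e]]]] := @spec_valP D U s P UP.
  exists V; split=> //; exists (r (a * d ^+ p.-1)), d => Q UQ VQ.
  have [dQ sQ] := e Q UQ VQ; exists dQ; apply: loc_frob_inj.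
  by rewrite (svalP (rt Q UQ)) sQ; apply/esym/frac_root.
exists (mk_spec_section hf); apply: spec_ext => P UP.
by rewrite spec_valX mk_spec_sectionE (svalP (rt P UP)).
Qed.

Lemma Spec_perfect : Fp_scheme p (Spec D) -> perfect_scheme p_prime (SpecS D).
Proof.
move=> hD; exists hD; apply: frobenius_iso => U; split.
  exact: natr_Fp_scheme.
exact: Spec_sections_perfect.
Qed.
End SpecPerfect.
End PerfectScheme.

(** * Quasi-compactness in affine schemes *)

(** Compactness as an induction principle. If P fails for K, the sets whose
    complement in K satisfies P form a proper filter; a cluster point of this
    filter in K has no open neighbourhood satisfying P. *)
Lemma compact_induction (T : topologicalType) (K : set T) (P : set T -> Prop) :
  compact K -> P set0 -> (forall A B, P A -> P B -> P (A `|` B)) ->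
  (forall A B, A `<=` B -> P B -> P A) ->
  (forall x, K x -> exists O, [/\ open O, O x & P O]) -> P K.
Proof.
move=> cK P0 PU PS Pnbhs; apply: contrapT => nPK.
pose F : set_system T := [set A | P (K `\` A)].
have FF : ProperFilter F.
  apply: Build_ProperFilter_ex => [A FA|].
    apply: contrapT => nA; apply: nPK; apply: PS FA => x Kx.
    by split=> // Ax; apply: nA; exists x.
  split.
  - by apply: PS P0 => x [_ nT]; case: nT.
  - move=> A B FA FB; apply: PS (PU _ _ FA FB) => x [Kx nAB].
    by have [Ax|nAx] := pselect (A x); [right|left]; split=> // Bx; apply: nAB.
  - by move=> A B AB; apply: PS => x [Kx nBx]; split=> // /AB.
have [|x [Kx xF]] := cK F FF; first by apply: PS P0 => x [].
have [O [oO Ox PO]] := Pnbhs x Kx.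
have [||y [nOy Oy]] := xF (~` O) O; last exact: nOy.
  by apply: PS PO => y [_ /contrapT].
exact: open_nbhs_nbhs.
Qed.

(** An ultrafilter of primes has a limit: the prime of all h that vanish at
    almost all points of the filter. It is an ideal because the filter is closed
    under intersection, and it is prime because the filter is ultra. *)
Lemma basic_compact (A : comPzRingType) (a : A) :
  compact (basic_opens a : set (spec_top A)).
Proof.
rewrite compact_ultra => F FU Fa.
pose inF h := F (~` (basic_opens h : set (spec_top A))).
have in0 : inF 0.
  by apply: filterS filterT => q _ /=; apply; apply: prime0.
have inD h k : inF h -> inF k -> inF (h + k).
  move=> Fh Fk; apply: filterS (filterI Fh Fk) => q [/contrapT qh /contrapT qk].
  by move=> /=; apply; apply: primeD.
have inMr h k : inF k -> inF (h * k).
  by move=> Fk; apply: filterS Fk => q /contrapT qk /=; apply; apply: primeMr.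
have in1 : ~ inF 1.
  move=> F1; apply: (@filter_not_empty _ F); apply: filterS F1 => q /=.
  by move/contrapT; apply: prime1.
have inM h k : inF (h * k) -> inF h \/ inF k.
  move=> Fhk; apply: contrapT => /not_orP[nh nk].
  have [Fh|//] := in_ultra_setVsetC (basic_opens h : set (spec_top A)) FU.
  have [Fk|//] := in_ultra_setVsetC (basic_opens k : set (spec_top A)) FU.
  apply: (@filter_not_empty _ F).
  apply: filterS (filterI Fhk (filterI Fh Fk)) => q [/contrapT].
  by move=> /primeM[qh []|qk []].
pose Q : spec_top A := PrimeIdeal in0 inD inMr in1 inM.
exists Q; split.
  move=> /= Fna; apply: (@filter_not_empty _ F).
  by apply: filterS (filterI Fa Fna) => q [].
move=> U; rewrite nbhsE => -[V [oV VQ] VU].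
have [h hQ hV] := oV _ VQ.
have [Fh|//] := in_ultra_setVsetC (basic_opens h : set (spec_top A)) FU.
by apply: filterS Fh => q /hV/VU.
Qed.

Lemma spec_nbhs (A : comPzRingType) (U : set (Spec A)) (P : Spec A) :
  open U -> U P -> exists a,
    (basic_opens a : set (Spec A)) P /\ basic_opens a `<=` U.
Proof. by move=> /spec_openP oU /oU[a aP aU]; exists a. Qed.

Definition unit_locus (X : ringedSpace) (U : opens X) (s : sheaf X U) : set X :=
  [set x | exists Ux : oset U x, is_unit (germ Ux s)].

(** Where the section is a fraction a / d, it is invertible exactly where a is;
    hence the locus is a finite union of basic open sets. *)
Lemma unit_locus_compact (A : comPzRingType) (U : opens (Spec A))
    (s : sheaf (Spec A) U) :
  compact (U : set (Spec A)) -> compact (unit_locus s).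
Proof.
move=> cU; set L := unit_locus s.
have [T [cT LT TL]] : exists T, [/\ compact T, U `&` L `<=` T & T `<=` L].
  apply: (compact_induction (P := fun S => exists T,
    [/\ compact T, S `&` L `<=` T & T `<=` L]) cU).
  - by exists set0; split; [exact: compact0|move=> x []|].
  - move=> S S' [T [cT ST TL]] [T' [cT' ST' TL']]; exists (T `|` T'); split.
    + exact: compactU.
    + by move=> x [[Sx|Sx] Lx]; [left; apply: ST|right; apply: ST'].
    + by move=> x [/TL|/TL'].
  - move=> S S' SS [T [cT ST TL]]; exists T; split=> // x [/SS Sx Lx].
    exact: ST.
  move=> P UP; have [V [VP VU [a [d e]]]] := @spec_valP A U s P UP.
  have [h [hP hV]] := spec_nbhs (openP V) VP.
  have hd Q : oset (basic_opens h) Q -> ~ pset (Q : spec_point A) d.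
    by move=> /hV VQ; have [] := e Q (VU _ VQ) VQ.
  have hU : basic_opens h `<=` U by move=> Q /hV/VU.
  have LE Q : oset (basic_opens h) Q -> L Q <-> ~ pset (Q : spec_point A) a.
    move=> hQ; rewrite -(spec_stalk_unit (p := Q) hQ a hd).
    have -> : spec_frac a hd = res (Spec A) hU s.
      apply: spec_ext => Q' hQ'; rewrite mk_spec_sectionE.
      have [dQ sQ] := e Q' (hU _ hQ') (hV _ hQ').
      apply: etrans (_ : frac a dQ = _); first exact: fracE.
      by rewrite -sQ.
    rewrite (germ_res (X := Spec A) (hU _ hQ) hQ hU).
    by split=> [[UQ]|u]; [rewrite (Prop_irrelevance UQ (hU _ hQ))|exists (hU _ hQ)].
  exists (basic_opens h); split=> //; first exact: openP.
  exists (basic_opens (h * a)); split; first exact: basic_compact.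
    by move=> Q [hQ /(LE _ hQ) aQ]; apply: nprimeM.
  move=> Q haQ; have hQ : oset (basic_opens h) Q.
    by move=> Qh; apply: haQ; rewrite mulrC; apply: primeMr.
  by apply/(LE _ hQ) => Qa; apply: haQ; apply: primeMr.
suff -> : L = T by [].
by apply/seteqP; split=> // x Lx; apply: LT; split=> //; case: Lx.
Qed.

(** Morphisms from affine schemes to affine schemes are quasi-compact. The
    target is the image of the open immersion c. A basic open subset c(D(b)) of
    it is the locus where the section of O_Y corresponding to b is invertible,
    so that its preimage is the locus where the pulled back section is
    invertible; every compact open subset is a finite union of these. *)
Section AffinePreimage.
Variables (Y : lrSpace) (B D : comPzRingType) (c : lrMor (Spec B) Y).
Variables (f : lrMor (Spec D) Y) (U : opens (Spec D)).
Hypotheses (oc : open_immersion c) (cU : compact (U : set (Spec D)))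
  (Uc : U `<=` f @^-1` range c).

Lemma affine_preimage_compact (W : opens Y) :
  W `<=` range c -> compact (W : set Y) -> compact (U `&` f @^-1` W).
Proof.
move=> Wc cW; have [ci co cb] := oc.
pose Y0 := Opens (co (oT _)).
have TY0 : oT _ `<=` c @^-1` Y0 by move=> q _; exists q.
have UY0 : U `<=` f @^-1` Y0 by move=> P /Uc.
have [T [cT WT TW]] : exists T, [/\ compact T, U `&` f @^-1` W `<=` T
    & T `<=` U `&` f @^-1` W].
  apply: (compact_induction (P := fun S => exists T,
    [/\ compact T, U `&` f @^-1` S `<=` T & T `<=` U `&` f @^-1` W]) cW).
  - by exists set0; split; [exact: compact0|move=> x []|].
  - move=> S S' [T [cT ST TL]] [T' [cT' ST' TL']]; exists (T `|` T'); split.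
    + exact: compactU.
    + by move=> x [Ux [Sx|Sx]]; [left; apply: ST|right; apply: ST'].
    + by move=> x [/TL|/TL'].
  - move=> S S' SS [T [cT ST TL]]; exists T; split=> // x [Ux /SS Sx].
    exact: ST.
  move=> y Wy; have [q _ cq] := Wc y Wy.
  have oW : open (c @^-1` W) := open_preimage (@rs_cont _ _ c) (openP W).
  have [|b [bq bW]] := @spec_nbhs _ _ q oW; first by rewrite /preimage /= cq.
  exists (c @` basic_opens b); split; [exact: co|by exists q|].
  pose sb : sheaf (Spec B) (oT _) :=
    spec_frac b (fun q (_ : oset (oT _) q) => @prime1 _ q).
  have [g _ gK] := cb Y0 (oT _) TY0 erefl.
  have locus z (Yz : oset Y0 z) :
      is_unit (germ Yz (g sb)) <-> (c @` basic_opens b) z.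
    have [q' _ cq'] := Yz; subst z.
    transitivity (is_unit (stalk_map c q' (germ Yz (g sb)))).
      by split; [apply: is_unit_rmorph|apply: lr_mor_local].
    rewrite (stalk_map_germ Yz (Logic.I : oset (oT (Spec B)) q') TY0) gK.
    rewrite (spec_stalk_unit (p := q')); split=> [bq'|[q'' bq'' /ci <-//]].
    by exists q'.
  exists (unit_locus (pull f UY0 (g sb))).
  have LE P (UP : oset U P) :
      unit_locus (pull f UY0 (g sb)) P <-> (c @` basic_opens b) (f P).
    rewrite -(locus _ (UY0 P UP)).
    transitivity (is_unit (stalk_map f P (germ (UY0 P UP : oset Y0 (f P)) (g sb)))).
      rewrite (stalk_map_germ (UY0 P UP : oset Y0 (f P)) UP UY0).
      by split=> [[UP']|u]; [rewrite (Prop_irrelevance UP' UP)|exists UP].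
    by split; [apply: lr_mor_local|apply: is_unit_rmorph].
  split; first exact: unit_locus_compact.
    by move=> P [UP bP]; apply/LE.
  move=> P LP; have [UP _] := LP; split=> //.
  by have [q' /bW Wq' cq'] := (LE P UP).1 LP; rewrite /preimage /= -cq'.
suff -> : U `&` f @^-1` W = T by [].
exact/seteqP.
Qed.
End AffinePreimage.

(** * Refining an fpqc morphism by perfect affine schemes *)

(** The inclusion of a component of a disjoint union is an isomorphism on
    stalks. *)
Lemma flat_copair (I : choiceType) (X : I -> scheme) (Y : scheme)
    (f : forall i, lrMor (X i) Y) :
  (forall i, flat (f i)) -> @flat (coprod X) Y (copair f).
Proof.
move=> ff [i x].
have bi : bijective (stalk_map (Defs.incl X i) x).
  by apply: open_immersion_stalk; apply: incl_open_immersion.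
apply: (flat_hom_factor (f := stalk_map (copair f) (coprod_in x))
  (h := stalk_map (Defs.incl X i) x) (f' := stalk_map (f i) x) _ bi (ff i x)).
elim/stalk_ind => V Vfx s.
pose U := opre (@copair_continuous I X Y f) V.
have Ux : oset U (coprod_in x) by [].
rewrite (@stalk_map_germ _ _ (copair f) (coprod_in x) V U Vfx Ux
  (@opre_sub _ _ _ _ _)).
rewrite (@stalk_map_germ _ _ (Defs.incl X i) x U (component i U) Ux Ux
  (@opre_sub _ _ _ _ _)).
rewrite (@stalk_map_germ _ _ (f i) x V (component i U) Vfx Ux
  (@copair_sub _ _ _ f V U (@opre_sub _ _ _ _ _) i)).
by rewrite /= /rmor_fun /incl_pull_fun res_id.
Qed.

(** A family of affine schemes over S inherits from S the property of being
    fpqc over Y as soon as it is flat over Y and the open sets among the images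
    of its basic open sets form a base of the topology of S. The members need
    not be open subschemes of S, which allows perfections of charts. *)
Section AffineRefinement.
Variables (S Y : scheme) (f : lrMor S Y).
Variables (I : choiceType) (D : I -> comPzRingType)
  (g : forall i, lrMor (Spec (D i)) S).
Hypotheses (ff : fpqc_morphism f)
  (flat_fg : forall i, @flat (SpecS (D i)) Y (lr_comp f (g i)))
  (base : forall (s : S) (V : set S), open V -> V s ->
     exists i a, [/\ (g i @` basic_opens a) s, g i @` basic_opens a `<=` V
       & open (g i @` basic_opens a)]).

Local Notation Z := (coprod (fun i => SpecS (D i))).
Local Notation fg := (copair (X := fun i => SpecS (D i))
  (fun i => lr_comp f (g i))).

Local Notation inZ i := (@coprod_in I (fun i => SpecS (D i)) i).

Let gZ (z : Z) : S := g (projT1 z) (projT2 z).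

(** What is asked from the neighbourhoods of an fpqc morphism, apart from the
    condition on their image; in this form it is stable under finite unions. *)
Let good (W : set Y) (Z' : set Z) : Prop :=
  [/\ open Z', Z' `<=` fg @^-1` W & forall W' : opens Y, W' `<=` W ->
      compact (W' : set Y) -> compact (Z' `&` fg @^-1` W')].

Let goodU W A B : good W A -> good W B -> good W (A `|` B).
Proof.
move=> [oA AW cA] [oB BW cB]; split.
- exact: openU.
- by move=> z [/AW|/BW].
- by move=> W' W'W cW'; rewrite setIUl; apply: compactU; [apply: cA|apply: cB].
Qed.

Let good_basic (B : comPzRingType) (c : lrMor (Spec B) Y) (W : set Y) i
    (a : D i) :
  open_immersion c -> W `<=` range c -> g i @` basic_opens a `<=` f @^-1` W ->
  good W (inZ i @` basic_opens a).
Proof.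
move=> oc Wc aW; split.
- by apply: existT_open_map; apply: openP.
- by move=> _ [P aP <-]; apply: aW; exists P.
move=> W' W'W cW'.
have -> : (inZ i @` basic_opens a) `&` fg @^-1` W' =
    inZ i @`
      (basic_opens a `&` lr_comp f (g i) @^-1` W').
  apply/seteqP; split=> [_ [[P aP <-] WP]|_ [P [aP WP] <-]]; first by exists P.
  by split=> //; exists P.
apply: continuous_compact.
  by apply: continuous_subspaceT; 
  exact: (@coprod_in_continuous I (fun i => SpecS (D i)) i).
apply: (affine_preimage_compact oc) => //.
- exact: basic_compact.
- by move=> P aP; apply: Wc; apply: aW; exists P.
- exact: subset_trans Wc.
Qed.

(** A neighbourhood of z with open image W and quasi-compact over W is obtained
    from finitely many basic open sets whose images cover the part K of V over
    W, which makes the image W, together with one basic open set around z. *)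
Lemma affine_refinement_fpqc :
  @fpqc_covering Y I (fun i => SpecS (D i)) (fun i => lr_comp f (g i)).
Proof.
have [[_ f_surj] f_qc] := ff.
split; first exact: flat_fg.
split.
  split; first exact: flat_copair.
  move=> y; have [s <-] := f_surj y.
  have [i [a [[P _ <-] _ _]]] := base openT (Logic.I : setT s).
  by exists (inZ i P).
move=> z; have [V [Vz oV qcV]] := f_qc (gZ z).
have [B [c [oc [q cq]]]] := sch_affine (f (gZ z)).
have [ci co _] := oc.
have [|b [bq bV]] := @spec_nbhs _ _ q (open_preimage (@rs_cont _ _ c) oV).
  by rewrite /preimage /= cq; exists (gZ z).
pose W : opens Y := Opens (co (basic_opens b)).
have WV : W `<=` f @` V by move=> _ [q' bq' <-]; apply: bV.
have Wc : W `<=` range c by move=> _ [q' _ <-]; exists q'.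
have cW : compact (W : set Y).
  apply: continuous_compact; last exact: basic_compact.
  by apply: continuous_subspaceT; apply: rs_cont.
pose K := V `&` f @^-1` W.
have oK : open K.
  by apply: openI (openP V) (open_preimage (@rs_cont _ _ f) (openP W)).
have Kz : K (gZ z) by split=> //; exists q.
have [Z' [gZ' KZ']] : exists Z', good W Z' /\ K `<=` gZ @` Z'.
  apply: (compact_induction (P := fun A => exists Z', good W Z' /\ A `<=` gZ @` Z')
    (qcV W WV cW)).
  - exists set0; split; last by move=> x [].
    split; [exact: open0|by move=> x []|move=> W' _ _].
    by rewrite set0I; apply: compact0.
  - move=> A A' [Z1 [g1 h1]] [Z2 [g2 h2]]; exists (Z1 `|` Z2).
    split; first exact: goodU.
    by move=> s [/h1|/h2] [x Zx <-]; exists x => //; [left|right].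
  - by move=> A A' AA' [Z1 [g1 h1]]; exists Z1; split=> // s /AA'/h1.
  move=> s Ks; have [i [a [as_ aK oa]]] := base oK Ks.
  exists (g i @` basic_opens a); split=> //.
  exists (inZ i @` basic_opens a); split.
    by apply: (good_basic oc Wc) => t /aK[].
  by move=> _ [P aP <-]; exists (inZ i P) => //; exists P.
case: z Vz cq Kz => i P Vz cq Kz.
have [a [aP aK]] := spec_nbhs (open_preimage (@rs_cont _ _ (g i)) oK) Kz.
have ga : good W (inZ i @` basic_opens a).
  by apply: (good_basic oc Wc) => _ [Q aQ <-]; have [] := aK Q aQ.
have [oU UW cU] := goodU gZ' ga.
exists (Opens oU); split.
- by right; exists P.
- rewrite (_ : _ @` _ = W); first exact: openP.
  apply/seteqP; split=> [_ [x /UW Wx <-] //|w Ww].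
  have [s Vs fs] := WV w Ww; have [|x Zx gx] := KZ' s.
    by split=> //; rewrite /preimage /= fs.
  by exists x; [left|rewrite -fs -gx].
- by move=> W' W'U cW'; apply: cU => // w /W'U[x /UW Wx <-].
Qed.
End AffineRefinement.

(** The members are the perfections of affine charts of S, one around each
    point. *)
Section PerfectRefinement.
Variables (p : nat) (p_prime : prime p) (S Y : scheme) (f : lrMor S Y).
Hypotheses (Yp : perfect_scheme p_prime Y) (ff : fpqc_morphism f).

Let chart_ex (s : S) : exists A : {A : comPzRingType & lrMor (Spec A) S},
  open_immersion (projT2 A) /\ exists y, projT2 A y = s.
Proof. by have [A [j h]] := sch_affine s; exists (existT _ A j). Qed.

Let A (s : S) : comPzRingType := projT1 (sval (cid (chart_ex s))).
Let c (s : S) : lrMor (Spec (A s)) S := projT2 (sval (cid (chart_ex s))).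
Let oc s : open_immersion (c s).
Proof. by case: (svalP (cid (chart_ex s))). Qed.
Let cs s : exists y, c s y = s.
Proof. by case: (svalP (cid (chart_ex s))). Qed.

Let D (s : S) : comPzRingType := perfection p_prime (A s).
Let r (s : S) : {rmorphism A s -> D s} := to_perfection p_prime (A s).
Let g (s : S) : lrMor (Spec (D s)) S := lr_comp (c s) (spec_map (r s)).

Let Fp_over (X : lrSpace) (h : lrMor X Y) : Fp_scheme p X.
Proof. by have [[e] _] := Yp; exact: (inhabits (lr_comp e h)). Qed.

Let r_surj s (Q : Spec (A s)) : exists P, spec_map (r s) P = Q.
Proof. by apply: spec_map_perfection_surj; apply: Fp_over (lr_comp f (c s)). Qed.

Let perfect_D s : perfect_scheme p_prime (SpecS (D s)).
Proof.
apply: Spec_perfect; first exact: perfection_perfect.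
exact: Fp_over (lr_comp f (g s)).
Qed.

Let flat_fg s : @flat (SpecS (D s)) Y (lr_comp f (g s)).
Proof.
move=> P; pose Q := spec_map (r s) P.
have [[ffl _] _] := ff.
have cb : bijective (stalk_map (c s) Q) by apply: open_immersion_stalk; apply: oc.
have Yperf y : perfect_ring p (stalk Y y).
  by apply: perfect_stalk => U; apply: perfect_scheme_sections.
have Dperf : perfect_ring p (stalk (Spec (D s)) P).
  by apply: perfect_stalk => U; 
  exact: (@perfect_scheme_sections p p_prime (SpecS (D s))).
pose h := stalk_map (spec_map (r s)) P \o stalk_map (c s) Q.
apply: (flat_perfection p_prime (f := stalk_map f (c s Q)) (g := h)) => //.
- move=> b; rewrite /h /=.
  have := stalk_map_comp (g := f) (f := g s) (x := P) b; rewrite /=.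
  by move=> ->; apply: (stalk_map_comp (g := c s) (f := spec_map (r s))).
- have [hS] : inhabited (Fp_scheme p S) by split; apply: Fp_over f.
  rewrite -(germ_nat (Logic.I : oset (oT S) (c s Q))).
  by rewrite (natr_Fp_scheme _ p_prime hS) germ0.
have [sur ker] := stalk_map_radicial P p_prime (to_perfection_radicial p_prime (A s)).
have [i [iK Ki]] := rmorphism_inv cb; split=> [d|a /ker[n [b e]]].
  have [n [b db]] := sur d; exists n, (i b).
  by rewrite /h /= Ki.
exists n, (i b); apply: (can_inj iK).
by rewrite rmorphM rmorphXn rmorph_nat Ki.
Qed.

Let base (s : S) (V : set S) : open V -> V s ->
  exists i a, [/\ (g i @` basic_opens a) s, g i @` basic_opens a `<=` V
    & open (g i @` basic_opens a)].
Proof.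
move=> oV Vs; have [y cy] := cs s.
have [|a [ay aV]] := @spec_nbhs _ _ y (open_preimage (@rs_cont _ _ (c s)) oV).
  by rewrite /preimage /= cy.
exists s, (r s a).
have -> : g s @` basic_opens (r s a) = c s @` basic_opens a.
  apply/seteqP; split=> [_ [P aP <-]|_ [Q aQ <-]].
    by exists (spec_map (r s) P).
  by have [P PQ] := r_surj Q; exists P; rewrite ?/g /= -?PQ // in aQ *.
split; [by exists y|by move=> _ [Q /aV ? <-]|].
by have [_ co _] := oc s; apply: co.
Qed.

(** The key to local surjectivity: every fpqc morphism to a perfect scheme is
    refined by an fpqc covering by perfect schemes. *)
Lemma perfect_refinement : exists (I : choiceType) (X : I -> scheme)
    (h : forall i, lrMor (X i) S),
  (forall i, perfect_scheme p_prime (X i)) /\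
  fpqc_covering (fun i => lr_comp f (h i)).
Proof.
exists S, (fun s => SpecS (D s)), g; split; first exact: perfect_D.
exact: affine_refinement_fpqc.
Qed.
End PerfectRefinement.

(** * Exactness of the perfected sequence *)

Lemma lr_comp_copair (I : choiceType) (X : I -> scheme) (Y Z : lrSpace)
    (g : lrMor Y Z) (f : forall i, lrMor (X i) Y) :
  lr_comp g (copair f) = copair (fun i => lr_comp g (f i)).
Proof.
apply: lrMor_ext => // V U hf hg s.
apply: functional_extensionality_dep => i.
exact: pull_irr.
Qed.

Lemma copair_congr (I : choiceType) (X : I -> scheme) (Y : lrSpace)
    (f g : forall i, lrMor (X i) Y) :
  (forall i, f i = g i) -> copair f = copair g.
Proof. by move=> fg; congr copair; apply: functional_extensionality_dep. Qed.

Theorem theorem6p1 (p : nat) (p_prime : prime p)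
    (k : fieldType) (k_char : p \in [pchar k])
    (k_perfect : bijective (fun x : k => x ^+ p))
    (F G H : groupObject (@Sch k)) (i : groupMor F G) (q : groupMor G H)
    (PF : inverse_perfection p_prime F)
    (PG : inverse_perfection p_prime G)
    (PH : inverse_perfection p_prime H) :
  fpqc_exact i q ->
  fpqc_exact (pf_mor PF PG i) (pf_mor PG PH q).
Proof.
move=> [i_inj i_ker q_surj].
have iE : km_comp (pf_phi PG) (pf_mor PF PG i) = km_comp i (pf_phi PF).
  exact: pf_mor_funE.
have qE : km_comp (pf_phi PH) (pf_mor PG PH q) = km_comp q (pf_phi PG).
  exact: pf_mor_funE.
split.
- move=> T a b ab; apply: pf_phi_inj; apply: (i_inj (sch_of_perf T)).
  by rewrite !km_compA -iE -!km_compA ab.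
- move=> T g; have oneE : km_comp (pf_phi PH) (go_one (pf_group PH) T) =
      go_one H (sch_of_perf T) by apply: pf_liftK.
  split=> [qg|[a <-]].
    have [|a ia] := (i_ker (sch_of_perf T) (km_comp (pf_phi PG) g)).1 _.
      by rewrite km_compA -qE -km_compA qg.
    exists (pf_lift PF a : kMor T (pf PF)); apply: pf_phi_inj.
    by rewrite km_compA iE -km_compA pf_liftK.
  apply: pf_phi_inj; rewrite oneE [LHS]km_compA qE -km_compA.
  apply/(i_ker (sch_of_perf T)); exists (km_comp (pf_phi PF) a).
  by rewrite !km_compA iE.
move=> U s.
have [J [X [f [[_ ff] lift]]]] := q_surj (sch_of_perf U) (km_comp (pf_phi PH) s).
have [g gE] : exists g : forall j, kMor (X j) G, forall j,
    km_comp q (g j) = km_comp (km_comp (pf_phi PH) s) (f j).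
  exists (fun j => sval (cid (lift j))) => j.
  exact: (svalP (cid (lift j))).
(* Gathering the covering and the lifts into single morphisms from S. *)
pose S : kScheme k := @KScheme k (coprod X) (copair (fun j => ks_str (X j))).
have fS : lr_comp (ks_str U) (copair (fun j => f j : lrMor (X j) U)) = ks_str S.
  by rewrite lr_comp_copair; apply: copair_congr => j; apply: km_str.
pose fs : kMor S U := @KMor k S U _ fS.
have gS : lr_comp (ks_str G) (copair (fun j => g j : lrMor (X j) G)) = ks_str S.
  by rewrite lr_comp_copair; apply: copair_congr => j; apply: km_str.
pose gs : kMor S G := @KMor k S G _ gS.
have gsE : km_comp q gs = km_comp (km_comp (pf_phi PH) s) fs.
  apply: kMor_ext; rewrite /= !lr_comp_copair; apply: copair_congr => j.
  exact: (congr1 (@km_mor k _ _) (gE j)).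
have [I [T [h [perfT cov]]]] := perfect_refinement (ob_in U) ff.
pose TS t : object (@Perf k p p_prime) :=
  @Object k (@Perf k p p_prime)
    (@KScheme k (T t) (lr_comp (ks_str S) (h t))) (perfT t).
pose hs t : kMor (TS t) S := @KMor k (TS t) S (h t) erefl.
exists I, TS, (fun t => km_comp fs (hs t)); split; first exact: cov.
move=> t; exists (pf_lift PG (km_comp gs (hs t)) : kMor (TS t) (pf PG)).
apply: pf_phi_inj. rewrite [LHS]km_compA qE -km_compA pf_liftK !km_compA gsE.
by [].
Qed.
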